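(* Let $y\in\mathbb T^N$. The following are equivalent: (i) $y\notin\mathcal A$; (ii) there exists $\mathbf w\in\mathcal H(0)$ which is strict at $y$; (iii) there exist $\mathbf w\in\mathcal H(0)$ and $i\in\{1,\dots,m\}$ such that $w_i$ is strict at $y$.
   Context: Let $N,m$ be positive integers, $\mathbb T^N=\mathbb R^N/\mathbb Z^N$ the flat torus. A convex Hamiltonian is a continuous $H:\mathbb T^N\times\mathbb R^N\to\mathbb R$ such that $p\mapsto H(x,p)$ is convex for every $x$ and there are $\alpha,\beta:\mathbb R_+\to\mathbb R$ tending to $+\infty$ at $+\infty$ with $\alpha(|p|)\leqslant H(x,p)\leqslant\beta(|p|)$ for all $(x,p)$. Let $H_1,\dots,H_m$ be convex Hamiltonians. An $m\times m$ real matrix $(b_{ij})$ is a coupling matrix if $b_{ij}\leqslant0$ for $j\ne i$ and $\sum_j b_{ij}\geqslant0$ for every $i$; it is degenerate if moreover $\sum_j b_{ij}=0$ for every $i$; a matrix is irreducible if for every nonempty $\mathcal I\subsetneq\{1,\dots,m\}$ there are $i\in\mathcal I$, $j\notin\mathcal I$ with $b_{ij}\neq0$. Let $B(x)=(b_{ij}(x))$ have continuous coefficients on $\mathbb T^N$ and be an irreducible degenerate coupling matrix for every $x$. Write $(B(x)\mathbf u(x))_i=\sum_j b_{ij}(x)u_j(x)$. For continuous $u$, $D^+u(x_0)$ (resp. $D^-u(x_0)$) is the set of $D\phi(x_0)$ with $\phi$ of class $C^1$ near $x_0$ and $u-\phi$ having a local maximum (resp. minimum) at $x_0$. For $a\in\mathbb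 R$, $\mathbf u\in(C(\mathbb T^N))^m$ is a (viscosity) subsolution [resp. supersolution] of $H_i(x,Du_i)+(B(x)\mathbf u(x))_i=a$ in $\mathbb T^N$, $i=1,\dots,m$, if for all $x$ and $i$: $H_i(x,p)+(B(x)\mathbf u(x))_i\leqslant a$ for all $p\in D^+u_i(x)$ [resp. $\geqslant a$ for all $p\in D^-u_i(x)$]; a solution is both. $\mathcal H(a)$ denotes the set of subsolutions (they are Lipschitz continuous). The critical value is $c=\inf\{a\in\mathbb R:\mathcal H(a)\neq\varnothing\}$; it is assumed, by normalization, that $c=0$. ''Critical'' sub/super/solutions refer to $a=0$. For $x,y\in\mathbb T^N$, $i,j\in\{1,\dots,m\}$ set $\Phi_{i,j}(y,x)=\sup_{\mathbf v\in\mathcal H(0)}\big(v_i(x)-v_j(y)\big)$, and let $\Phi_{\cdot,j}(y,\cdot)=(\Phi_{1,j}(y,\cdot),\dots,\Phi_{m,j}(y,\cdot))^T$. The Aubry set is $\mathcal A=\{y\in\mathbb T^N:\Phi_{\cdot,i}(y,\cdot)\text{ is a critical solution}\}$, where $i$ is any fixed index (the set does not depend on $i$). For $\mathbf v\in\mathcal H(0)$, $v_i$ is strict at $y$ if there are an open neighborhood $V$ of $y$ and $\delta>0$ such that $H_i(x,Dv_i(x))+(B(x)\mathbf v(x))_i<-\delta$ for a.e. $x\in V$. $\mathbf v$ is strict at $y$ if $v_i$ is strict at $y$ for every $i\in\{1,\dots,m\}$. *)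

(* Defs.v *)
From HB Require Import structures.
From mathcomp Require Import all_boot all_order all_algebra.
From mathcomp Require Import all_classical all_reals all_analysis.

Set Implicit Arguments.
Unset Strict Implicit.
Unset Printing Implicit Defensive.

Import Order.TTheory GRing.Theory Num.Theory.
Import numFieldNormedType.Exports.

Local Open Scope classical_set_scope.
Local Open Scope ring_scope.

(* A point of T^N = R^N / Z^N is given by any of its representatives in
   'rV[R]_N, and a function on T^N is a Z^N-periodic function on 'rV[R]_N.
   An m-tuple of functions is written u : 'I_m -> 'rV[R]_N -> R. *)
Definition torus_fun (R : realType) (N : nat) (T : Type) (f : 'rV[R]_N -> T) :=
  forall (x : 'rV[R]_N) (k : 'rV[int]_N), f (x + map_mx intr k) = f x.

(* The library norm `|p| on 'rV[R]_N is the sup norm. *)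
Definition enorm (R : realType) (N : nat) (p : 'rV[R]_N) : R :=
  Num.sqrt (\sum_(k < N) p ord0 k ^+ 2).

(* Only the values of alpha and beta on [0, +oo[ matter. *)
Definition convex_hamiltonian (R : realType) (N : nat)
    (H : 'rV[R]_N -> 'rV[R]_N -> R) : Prop :=
  [/\ continuous (fun z : 'rV[R]_N * 'rV[R]_N => H z.1 z.2),
      torus_fun H,
      forall x, convex_function (E := 'rV[R]_N) [set: 'rV[R]_N] (H x) &
      exists alpha beta : R -> R,
        [/\ alpha s @[s --> +oo] --> +oo,
            beta s @[s --> +oo] --> +oo &
            forall x p, alpha (enorm p) <= H x p <= beta (enorm p)]].

Definition coupling_matrix (R : realType) (m : nat) (b : 'M[R]_m) : Prop :=
  (forall i j, j != i -> b i j <= 0) /\ (forall i, 0 <= \sum_(j < m) b i j).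

Definition degenerate_coupling_matrix (R : realType) (m : nat) (b : 'M[R]_m) :
    Prop :=
  coupling_matrix b /\ (forall i, \sum_(j < m) b i j = 0).

Definition irreducible_matrix (R : realType) (m : nat) (b : 'M[R]_m) : Prop :=
  forall I : {set 'I_m}, I != finset.set0 -> I \proper [set: 'I_m]%SET ->
    exists i j, [/\ i \in I, j \notin I & b i j != 0].

Definition gradient (R : realType) (N : nat) (f : 'rV[R]_N -> R)
    (x : 'rV[R]_N) : 'rV[R]_N :=
  \row_(k < N) 'd f x (delta_mx ord0 k).

Definition C1_near (R : realType) (N : nat) (phi : 'rV[R]_N -> R)
    (x0 : 'rV[R]_N) : Prop :=
  \forall x \near x0, differentiable phi x /\ {for x, continuous (gradient phi)}.

Definition superdiff (R : realType) (N : nat) (u : 'rV[R]_N -> R)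
    (x0 : 'rV[R]_N) : set 'rV[R]_N :=
  [set p | exists phi : 'rV[R]_N -> R,
    [/\ C1_near phi x0,
        \forall x \near x0, u x - phi x <= u x0 - phi x0 &
        p = gradient phi x0]].

Definition subdiff (R : realType) (N : nat) (u : 'rV[R]_N -> R)
    (x0 : 'rV[R]_N) : set 'rV[R]_N :=
  [set p | exists phi : 'rV[R]_N -> R,
    [/\ C1_near phi x0,
        \forall x \near x0, u x0 - phi x0 <= u x - phi x &
        p = gradient phi x0]].

Definition coupling_term (R : realType) (N m : nat) (B : 'rV[R]_N -> 'M[R]_m)
    (u : 'I_m -> 'rV[R]_N -> R) (x : 'rV[R]_N) (i : 'I_m) : R :=
  \sum_(j < m) B x i j * u j x.

Definition continuous_on_torus (R : realType) (N m : nat)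
    (u : 'I_m -> 'rV[R]_N -> R) : Prop :=
  forall i, continuous (u i) /\ torus_fun (u i).

Definition subsolution (R : realType) (N m : nat)
    (H : 'I_m -> 'rV[R]_N -> 'rV[R]_N -> R) (B : 'rV[R]_N -> 'M[R]_m)
    (a : R) (u : 'I_m -> 'rV[R]_N -> R) : Prop :=
  continuous_on_torus u /\
  forall x i p, superdiff (u i) x p -> H i x p + coupling_term B u x i <= a.

Definition supersolution (R : realType) (N m : nat)
    (H : 'I_m -> 'rV[R]_N -> 'rV[R]_N -> R) (B : 'rV[R]_N -> 'M[R]_m)
    (a : R) (u : 'I_m -> 'rV[R]_N -> R) : Prop :=
  continuous_on_torus u /\
  forall x i p, subdiff (u i) x p -> a <= H i x p + coupling_term B u x i.

Definition solution (R : realType) (N m : nat)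
    (H : 'I_m -> 'rV[R]_N -> 'rV[R]_N -> R) (B : 'rV[R]_N -> 'M[R]_m)
    (a : R) (u : 'I_m -> 'rV[R]_N -> R) : Prop :=
  subsolution H B a u /\ supersolution H B a u.

(* Taken in \bar R because [inf] on R is 0 on sets that are empty or not
   bounded below. *)
Definition critical_value (R : realType) (N m : nat)
    (H : 'I_m -> 'rV[R]_N -> 'rV[R]_N -> R) (B : 'rV[R]_N -> 'M[R]_m) : \bar R :=
  ereal_inf [set a%:E | a in [set a : R | exists u, subsolution H B a u]].

(* Phi H B i j y x is Phi_{i,j}(y, x). When the critical value is 0 the set is
   nonempty and bounded above, so that the real-valued [sup] is the supremum. *)
Definition Phi (R : realType) (N m : nat)
    (H : 'I_m -> 'rV[R]_N -> 'rV[R]_N -> R) (B : 'rV[R]_N -> 'M[R]_m)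
    (i j : 'I_m) (y x : 'rV[R]_N) : R :=
  sup [set v i x - v j y | v in [set v | subsolution H B 0 v]].

Definition Aubry_set (R : realType) (N m : nat)
    (H : 'I_m -> 'rV[R]_N -> 'rV[R]_N -> R) (B : 'rV[R]_N -> 'M[R]_m)
    (i : 'I_m) : set 'rV[R]_N :=
  [set y | solution H B 0 (fun k => Phi H B k i y)].

Definition box (R : realType) (N : nat) (ab : 'rV[R]_N * 'rV[R]_N) :
    set 'rV[R]_N :=
  [set x | forall k, ab.1 ord0 k <= x ord0 k <= ab.2 ord0 k].

Definition box_volume (R : realType) (N : nat) (ab : 'rV[R]_N * 'rV[R]_N) : R :=
  \prod_(k < N) (ab.2 ord0 k - ab.1 ord0 k).

(* N-dimensional Lebesgue outer measure, by countable covers by boxes. *)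
Definition lebesgue_outer (R : realType) (N : nat) (A : set 'rV[R]_N) : \bar R :=
  ereal_inf [set (\sum_(0 <= n <oo) (box_volume (F n))%:E)%E | F in
    [set F : nat -> 'rV[R]_N * 'rV[R]_N |
      (forall n k, (F n).1 ord0 k <= (F n).2 ord0 k) /\
      A `<=` \bigcup_n box (F n)]].

Definition ae_in (R : realType) (N : nat) (V : set 'rV[R]_N)
    (P : 'rV[R]_N -> Prop) : Prop :=
  lebesgue_outer [set x | V x /\ ~ P x] = 0%E.

(* Differentiability is part of the a.e. condition because [gradient] has an
   irrelevant value where v_i is not differentiable; critical subsolutions are
   Lipschitz, hence differentiable almost everywhere. *)
Definition strict_component_at (R : realType) (N m : nat)
    (H : 'I_m -> 'rV[R]_N -> 'rV[R]_N -> R) (B : 'rV[R]_N -> 'M[R]_m)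
    (v : 'I_m -> 'rV[R]_N -> R) (i : 'I_m) (y : 'rV[R]_N) : Prop :=
  exists (V : set 'rV[R]_N) (delta : R),
    [/\ open V, V y, 0 < delta &
        ae_in V (fun x => differentiable (v i) x /\
          H i x (gradient (v i) x) + coupling_term B v x i < - delta)].

Definition strict_at (R : realType) (N m : nat)
    (H : 'I_m -> 'rV[R]_N -> 'rV[R]_N -> R) (B : 'rV[R]_N -> 'M[R]_m)
    (v : 'I_m -> 'rV[R]_N -> R) (y : 'rV[R]_N) : Prop :=
  forall i, strict_component_at H B v i y.

(* Main.v *)
Require Import Defs.
From HB Require Import structures.
From mathcomp Require Import all_boot all_order all_algebra.
From mathcomp Require Import all_classical all_reals all_analysis.
From mathcomp Require Import measurable_realfun.
From mathcomp Require Import ring lra.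

Set Implicit Arguments.
Unset Strict Implicit.
Unset Printing Implicit Defensive.

Import Order.TTheory GRing.Theory Num.Theory.
Import numFieldNormedType.Exports.

Local Open Scope classical_set_scope.
Local Open Scope ring_scope.

(** Why the theorem is true.

    A subsolution is controlled through its increments along segments.  If
    every superdifferential of [u] near a segment lies in a half-space
    [q . e <= s], then [u] grows by at most [s] along the segment
    ([superdiff_increment]); conversely such a bound on increments passes to
    all superdifferentials, subdifferentials and gradients.  Since a sublevel
    of a convex Hamiltonian is an intersection of half-spaces, and the
    half-space that separates a given covector works for all nearby base
    points ([ham_support]), viscosity inequalities can be moved freely between
    these three notions.  In particular a viscosity subsolution satisfies its
    inequality on subdifferentials too ([subdiff_subsolution]), a
    Lipschitz function satisfying it almost everywhere satisfies it in the
    viscosity sense ([ae_strict_visc]), and the inequality survives pointwise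
    suprema and limits ([envelope_subsolution]).  Irreducibility of the
    coupling bounds the oscillation between components, hence gives a common
    Lipschitz constant ([subsolution_bounds]); so critical subsolutions exist
    and every [Phi(y, .)] is one.

    Critical subsolutions are modified by taking a local maximum with a
    function [f] that is a strict subsolution of one equation where it emerges
    ([glue_subsolution]).  Raising one component only lowers the coupling term
    of the others, so the other equations are preserved.  With [f] a slightly
    raised test function touching from below, a negative value of the equation
    on a subdifferential at [y] yields a subsolution whose component is C^1
    near [y] and strict there ([smooth_raise]).  A merely strict component may
    have no subdifferential at [y]; one first glues in a translate of itself
    that brings to [y] a nearby point where one exists ([strict_smoothing]).
    Raising the [k]-th component at [y] further makes strict each equation
    [j] with [b_jk(y) <> 0], and irreducibility carries strictness to all
    components ([all_smooth_strict]).

    If [y] is outside the Aubry set, [Phi(y, .)] is a subsolution that fails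
    to be a supersolution at some point.  A failure off the lattice orbit of
    [y] would let one raise [Phi(y, .)] there without changing its value at
    [y], against its maximality; so the failure is at [y] and produces a
    subsolution with all components C^1 near [y] and strict.  For such a
    subsolution the almost-everywhere condition holds everywhere near [y].
    Conversely, a subsolution with one strict component gives a subsolution
    [v] all of whose components are smooth and strict at [y].  The function
    [v_i0 - v_i0(y)] touches [Phi_{i0,i0}(y, .)] from below at [y], and the
    coupling term of [Phi(y, .)] at [y] is at most that of [v]; hence the
    supersolution property of [Phi(y, .)] fails at [y]. *)

(** * First-order expansions of functions on R^N *)

Definition dot (R : realType) (N : nat) (p q : 'rV[R]_N) : R :=
  \sum_(k < N) p ord0 k * q ord0 k.

Section Dot.
Variables (R : realType) (N : nat).
Implicit Types (p q x y z : 'rV[R]_N) (c : R).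

Lemma dotC p q : dot p q = dot q p.
Proof. by apply: eq_bigr => k _; rewrite mulrC. Qed.

Lemma dotDl p q z : dot (p + q) z = dot p z + dot q z.
Proof. by rewrite -big_split; apply: eq_bigr => k _; rewrite mxE mulrDl. Qed.

Lemma dotZl c p q : dot (c *: p) q = c * dot p q.
Proof. by rewrite /dot mulr_sumr; apply: eq_bigr => k _; rewrite mxE mulrA. Qed.

Lemma dotNl p q : dot (- p) q = - dot p q.
Proof. by rewrite -scaleN1r dotZl mulN1r. Qed.

Lemma dotDr p q z : dot z (p + q) = dot z p + dot z q.
Proof. by rewrite dotC dotDl !(dotC z). Qed.

Lemma dotZr c p q : dot q (c *: p) = c * dot q p.
Proof. by rewrite dotC dotZl (dotC q). Qed.

Lemma dotNr p q : dot q (- p) = - dot q p.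
Proof. by rewrite dotC dotNl (dotC q). Qed.

Lemma dot0l q : dot 0 q = 0.
Proof. by rewrite -(scale0r q) dotZl mul0r. Qed.

Lemma dot0r q : dot q 0 = 0.
Proof. by rewrite dotC dot0l. Qed.

Lemma dot_ge0 p : 0 <= dot p p.
Proof. by apply: sumr_ge0 => k _; rewrite -expr2 sqr_ge0. Qed.

Lemma dot_delta p k : dot p (delta_mx ord0 k) = p ord0 k.
Proof.
rewrite /dot (bigD1 k) //= big1 ?addr0 ?mxE ?eqxx ?mulr1 // => j jk.
by rewrite mxE eqxx (negPf jk) mulr0.
Qed.

(** The library norm is the sup norm, whereas quadratic test functions use the
    Euclidean product [dot]; this and the next lemmas compare the two. *)
Lemma coord_le_norm x k : `|x ord0 k| <= `|x|.
Proof.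
rewrite [leRHS]/Num.norm /= mx_normrE.
by apply: le_trans (le_bigmax _ (fun ij => `|x ij.1 ij.2|) (ord0, k)).
Qed.

Lemma norm_le_coord x c : 0 <= c -> (forall k, `|x ord0 k| <= c) -> `|x| <= c.
Proof.
move=> c0 h; rewrite /Num.norm /= mx_normrE; apply/bigmax_leP; split => //.
by move=> [i k] _ /=; rewrite (ord1 i).
Qed.

Lemma dot_le_norm p q : `|dot p q| <= N%:R * (`|p| * `|q|).
Proof.
apply: le_trans (ler_norm_sum _ _ _) _.
apply: le_trans (_ : \sum_(k < N) `|p| * `|q| <= _).
  apply: ler_sum => k _; rewrite normrM.
  by apply: ler_pM => //; apply: coord_le_norm.
by rewrite sumr_const card_ord mulr_natl.
Qed.

Lemma norm_le_dot x : `|x| ^+ 2 <= dot x x.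
Proof.
have [->|x0] := eqVneq x 0; first by rewrite normr0 expr0n dot0l.
have : mx_norm x != 0 by apply: contra x0 => /eqP/mx_norm_eq0 ->.
move=> /mx_norm_neq0 [[i k]] /=; rewrite (ord1 i) => e.
rewrite [`|x|]e -normrX ger0_norm ?sqr_ge0 // /dot (bigD1 k) //= -expr2.
by rewrite lerDl; apply: sumr_ge0 => j _; rewrite -expr2 sqr_ge0.
Qed.

End Dot.

Section Metric.
Variables (R : realType) (V : normedModType R).

Lemma near_normP (x0 : V) (P : V -> Prop) :
  (\forall x \near x0, P x) <->
  exists2 r : R, 0 < r & forall x, `|x - x0| < r -> P x.
Proof.
split.
  move=> /nbhs_normP [r /= r0 h]; exists r => // x xr; apply: h.
  by rewrite /= -normrN opprB.
case=> r r0 h; apply/nbhs_normP; exists r => // x /= xr; apply: h.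
by rewrite -normrN opprB.
Qed.

Lemma cont_normP (W : normedModType R) (f : V -> W) (x0 : V) :
  {for x0, continuous f} <->
  forall eps, 0 < eps ->
    exists2 r : R, 0 < r & forall x, `|x - x0| < r -> `|f x - f x0| < eps.
Proof.
split.
  move=> /cvgrPdist_lt h eps /h /near_normP [r r0 {}h]; exists r => // x xr.
  by rewrite -normrN opprB; apply: h.
move=> h; apply/cvgrPdist_lt => eps /h [r r0 {}h]; apply/near_normP.
by exists r => // x /h; rewrite -normrN opprB.
Qed.

End Metric.

Section Gradient.
Variables (R : realType) (N : nat).
Implicit Types (f g : 'rV[R]_N -> R) (p q x y z h a e : 'rV[R]_N).
Implicit Types (c r s t eps : R).

(** The epsilon-delta form of differentiability at [x] with gradient [p]. *)
Definition expands f x p := forall eps : R, 0 < eps ->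
  exists2 r : R, 0 < r &
    forall h, `|h| < r -> `|f (x + h) - f x - dot p h| <= eps * `|h|.

Lemma diff_expands f x : differentiable f x -> expands f x (gradient f x).
Proof.
move=> df eps e0.
have gE h : 'd f x h = dot (gradient f x) h.
  rewrite {1}[h]row_sum_delta linear_sum /=; apply: eq_bigr => k _.
  by rewrite linearZ mxE mulrC.
have := diff_locally df; move/eqaddoP => /(_ _ e0) /near_normP [r r0 hr].
exists r => // h hh; have := hr h; rewrite subr0 => /(_ hh) /=.
rewrite -[(_ - _) h]/(f (h + x) - (f x + 'd f x h)) gE opprD addrA.
by rewrite (addrC h).
Qed.

Lemma continuous_dot p : continuous (dot p).
Proof.
move=> x; apply/cont_normP => eps e0.
exists (eps / (N%:R * `|p| + 1)); first by rewrite divr_gt0 // ltr_wpDl // mulr_ge0.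
move=> z; rewrite ltr_pdivlMr ?ltr_wpDl ?mulr_ge0 // => hz.
rewrite -dotNr -dotDr; apply: le_lt_trans (dot_le_norm _ _) _.
by apply: le_lt_trans hz; rewrite mulrDr mulr1 mulrA mulrC lerDl.
Qed.

Lemma expands_diff f x p : expands f x p ->
  differentiable f x /\ gradient f x = p.
Proof.
move=> ef.
have dl : linear (dot p).
  by move=> c u v; rewrite dotDr dotZr.
pose L := HB.pack_for {linear 'rV[R]_N -> R} (dot p)
  (GRing.isLinear.Build _ _ _ _ (dot p) dl).
have e1 : f \o shift x = cst (f x) + L +o_ (0 : 'rV[R]_N) id.
  apply/eqaddoP => eps e0; have [r r0 hr] := ef _ e0.
  suff : \forall h \near (0 : 'rV[R]_N),
    `|(f \o shift x - (cst (f x) + L)) h| <= eps * `|h| by [].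
  apply/near_normP; exists r => // h; rewrite subr0 => /hr /=.
  move=> hh.
  rewrite -[X in `|X| <= _]/(f (h + x) - (f x + dot p h)) opprD addrA.
  by rewrite (addrC h).
have e2 : 'd f x = L :> (_ -> _) by apply: diff_unique => //; exact: continuous_dot.
split.
  by apply/diff_locallyP; rewrite e2; split => //; exact: continuous_dot.
by apply/rowP => k; rewrite mxE e2 /= dot_delta.
Qed.

Lemma expands_local f g x p r : 0 < r ->
  (forall y, `|y - x| < r -> f y = g y) -> expands f x p -> expands g x p.
Proof.
move=> r0 fg ef eps /ef [s s0 h]; exists (Num.min r s).
  by rewrite lt_min r0.
move=> k; rewrite lt_min => /andP [kr ks]; rewrite -!fg ?subrr ?normr0 //.
  exact: h.
by rewrite addrC addKr.
Qed.

Lemma expandsD f g x p q : expands f x p -> expands g x q ->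
  expands (fun y => f y + g y) x (p + q).
Proof.
move=> ef eg eps e0; have e2 : 0 < eps / 2 by rewrite divr_gt0.
have [r r0 hr] := ef _ e2; have [s s0 hs] := eg _ e2.
exists (Num.min r s); first by rewrite lt_min r0.
move=> k; rewrite lt_min => /andP [kr ks]; have := hr _ kr; have := hs _ ks.
rewrite dotDl !ler_norml => /andP[a1 a2] /andP [b1 b2]; apply/andP; split; lra.
Qed.

Lemma expandsN f x p : expands f x p -> expands (fun y => - f y) x (- p).
Proof.
move=> ef eps /ef [r r0 hr]; exists r => // k /hr; rewrite dotNl.
move=> hk.
rewrite (_ : - f (x + k) - - f x - - dot p k = - (f (x + k) - f x - dot p k)).
  by rewrite normrN.
by ring.
Qed.

Lemma expands_cst c x : expands (fun=> c) x 0.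
Proof.
move=> eps e0; exists 1 => // h _; rewrite dot0l !subrr normr0.
by rewrite mulr_ge0 // ltW.
Qed.

Lemma expands_sqr c a x :
  expands (fun y => c * dot (y - a) (y - a)) x ((2 * c) *: (x - a)).
Proof.
move=> eps e0.
exists (eps / (`|c| * N%:R + 1)).
  by rewrite divr_gt0 // ltr_wpDl // mulr_ge0.
move=> h hr.
have -> : c * dot (x + h - a) (x + h - a) - c * dot (x - a) (x - a) -
   dot ((2 * c) *: (x - a)) h = c * dot h h.
  rewrite (_ : x + h - a = (x - a) + h); last by rewrite addrAC.
  rewrite dotDl 2!(dotDr (x - a) h) dotZl (dotC h (x - a)); ring.
rewrite normrM; apply: le_trans (ler_wpM2l (normr_ge0 _) (dot_le_norm _ _)) _.
rewrite !mulrA; apply: ler_wpM2r => //.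
rewrite ltr_pdivlMr in hr; last by rewrite ltr_wpDl // mulr_ge0.
apply: le_trans (ltW hr); rewrite mulrDr mulr1 mulrC lerDl //.
Qed.

Lemma expands_shift f x a p :
  expands f (x + a) p -> expands (fun y => f (y + a)) x p.
Proof.
by move=> ef eps /ef [r r0 hr]; exists r => // h /hr; rewrite (addrAC x a).
Qed.

(** Only small steps in the direction [e] matter, so a one-sided bound on these
    increments already bounds the derivative in that direction. *)
Lemma expands_slope_le f x p e s r : 0 < r -> expands f x p ->
  (forall t, 0 < t < r -> f (x + t *: e) <= f x + s * t) -> dot p e <= s.
Proof.
move=> r0 ef hs; rewrite leNgt; apply/negP => se.
have d0 : 0 < (dot p e - s) / 2 / (`|e| + 1).
  by rewrite !divr_gt0 ?subr_gt0 // ltr_wpDl.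
have [r1 r10 h] := ef _ d0.
pose t := Num.min (r / 2) (r1 / 2 / (`|e| + 1)).
have t0 : 0 < t by rewrite lt_min !divr_gt0 // ltr_wpDl.
have tr : t < r by rewrite gt_min ltr_pdivrMr // ltr_pMr // ltr1n.
have te : `|t *: e| < r1.
  rewrite normrZ gtr0_norm //.
  have : t <= r1 / 2 / (`|e| + 1) by rewrite ge_min lexx orbT.
  rewrite ler_pdivlMr ?ltr_wpDl // => h1.
  have : t * `|e| <= t * (`|e| + 1) by rewrite ler_pM2l // lerDl.
  lra.
have := h _ te; have := hs t; rewrite t0 tr => /(_ isT) h1.
rewrite ler_norml dotZr normrZ gtr0_norm // => /andP [h2 _].
have e1 : (dot p e - s) / 2 / (`|e| + 1) * (t * `|e|) <=  (dot p e - s) / 2 * t.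
  rewrite -mulrA; apply: ler_wpM2l.
    by rewrite divr_ge0 // subr_ge0 ltW.
  rewrite mulrC ler_pdivrMr ?ltr_wpDl //.
  by rewrite ler_pM2l // lerDl.
have : 0 < (dot p e - s) * t by rewrite mulr_gt0 // subr_gt0.
lra.
Qed.

End Gradient.

(** * Semidifferentials and increments along segments *)

Section Semidifferentials.
Variables (R : realType) (N : nat).
Implicit Types (f g u v : 'rV[R]_N -> R) (p q x y z h a e : 'rV[R]_N).
Implicit Types (c r s t eps eta rho : R).

Lemma dot_eq0 p : dot p p = 0 -> p = 0.
Proof.
move=> h; have := norm_le_dot p; rewrite h => h1.
by apply/eqP; rewrite -normr_eq0 -sqrf_eq0 eq_le h1 sqr_ge0.
Qed.

(** [C1_near] refers to the gradient chosen by the library; any continuous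
    field of first-order expansions coincides with it near the point. *)
Lemma C1_nearI f (G : 'rV[R]_N -> 'rV[R]_N) x r : 0 < r ->
  (forall y, `|y - x| < r -> expands f y (G y)) ->
  (forall y, `|y - x| < r -> {for y, continuous G}) -> C1_near f x.
Proof.
move=> r0 fG cG; apply/near_normP; exists r => // y yr.
have [df _] := expands_diff (fG _ yr); split => //.
apply/cont_normP => eps e0.
have /cont_normP /(_ _ e0) [s s0 hs] := cG _ yr.
exists (Num.min s (r - `|y - x|)); first by rewrite lt_min s0 subr_gt0.
move=> z; rewrite lt_min => /andP [zs zr].
have zx : `|z - x| < r.
  by have := ler_distD y z x; lra.
have [_ ->] := expands_diff (fG _ zx); have [_ ->] := expands_diff (fG _ yr).
exact: hs.
Qed.

Lemma C1_nearE f x : C1_near f x -> exists2 r, 0 < r & forall y, `|y - x| < r ->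
  expands f y (gradient f y) /\ {for y, continuous (gradient f)}.
Proof.
move=> /near_normP [r r0 h]; exists r => // y /h [df cf]; split => //.
exact: diff_expands.
Qed.

Lemma continuous_affine c a : continuous (fun z : 'rV[R]_N => c *: (z - a)).
Proof.
move=> y; apply/cont_normP => eps e0; exists (eps / (`|c| + 1)).
  by rewrite divr_gt0 // ltr_wpDl.
move=> z; rewrite ltr_pdivlMr ?ltr_wpDl // => zy.
rewrite -scalerBr opprB addrA subrK normrZ mulrC.
by apply: le_lt_trans zy; rewrite mulrDr mulr1 lerDl.
Qed.

Lemma C1_near_add_sqr f c a x : C1_near f x ->
  C1_near (fun y => f y + c * dot (y - a) (y - a)) x.
Proof.
move=> /C1_nearE [r r0 h].
apply: (C1_nearI (r := r) (G := fun y => gradient f y + (2 * c) *: (y - a))) => //.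
  by move=> y /h [ef _]; apply: expandsD => //; exact: expands_sqr.
move=> y /h [_ cf].
apply: (@continuousD _ _ _ (gradient f) (fun z => (2 * c) *: (z - a)) y cf).
exact: continuous_affine.
Qed.

Lemma C1_near_cst c x : C1_near (fun=> c) x.
Proof.
apply: (C1_nearI (r := 1) (G := fun=> 0)) => //.
  by move=> y _; exact: expands_cst.
by move=> y _; apply: cst_continuous.
Qed.

Lemma C1_near_sqr c a x : C1_near (fun y => c * dot (y - a) (y - a)) x.
Proof.
have -> : (fun y => c * dot (y - a) (y - a)) =
          (fun y => (fun=> 0) y + c * dot (y - a) (y - a)).
  by apply/funext => y; rewrite add0r.
by apply: C1_near_add_sqr; exact: C1_near_cst.
Qed.

Lemma C1_near_opp f x : C1_near f x -> C1_near (fun y => - f y) x.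
Proof.
move=> /C1_nearE [r r0 h].
apply: (C1_nearI (r := r) (G := fun y => - gradient f y) r0).
  by move=> y /h [ef _]; exact: expandsN.
by move=> y /h [_ cf]; apply: continuousN; exact: cf.
Qed.

Lemma C1_near_local f g x r : 0 < r -> (forall y, `|y - x| < r -> f y = g y) ->
  C1_near f x -> C1_near g x.
Proof.
move=> r0 fg /C1_nearE [s s0 h].
apply: (C1_nearI (r := Num.min r s) (G := gradient f)).
- by rewrite lt_min r0.
- move=> y; rewrite lt_min => /andP [yr /h [ef _]].
  apply: (@expands_local _ _ f _ _ _ (r - `|y - x|)) => //.
    by rewrite subr_gt0.
  by move=> z zy; apply: fg; have := ler_distD y z x; lra.
- by move=> y; rewrite lt_min => /andP [_ /h []].
Qed.

Lemma C1_near_shift f a x : C1_near f (x + a) -> C1_near (fun y => f (y + a)) x.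
Proof.
move=> /C1_nearE [r r0 h].
have e (y : 'rV[R]_N) : y - x = y + a - (x + a) by rewrite opprD addrACA subrr addr0.
apply: (C1_nearI (r := r) (G := fun y => gradient f (y + a))) => //.
  by move=> y; rewrite e => /h [ef _]; exact: expands_shift.
move=> y; rewrite e => /h [_ cf].
apply/cont_normP => eps e0; have /cont_normP /(_ _ e0) [s s0 hs] := cf.
by exists s => // z zs; apply: hs; rewrite opprD addrACA subrr addr0.
Qed.

Lemma superdiff_touch u x p : superdiff u x p ->
  exists f, [/\ C1_near f x, expands f x p & exists2 r, 0 < r &
     forall y, `|y - x| < r -> u y - f y <= u x - f x].
Proof.
move=> [f [C1 /near_normP hu ->]]; exists f; split => //.
by have [r r0 h] := C1_nearE C1; have [] := h x; rewrite ?subrr ?normr0.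
Qed.

Lemma subdiff_touch u x p : subdiff u x p ->
  exists f, [/\ C1_near f x, expands f x p & exists2 r, 0 < r &
     forall y, `|y - x| < r -> u x - f x <= u y - f y].
Proof.
move=> [f [C1 /near_normP hu ->]]; exists f; split => //.
by have [r r0 h] := C1_nearE C1; have [] := h x; rewrite ?subrr ?normr0.
Qed.

Lemma superdiffI u x p f r : C1_near f x -> expands f x p -> 0 < r ->
  (forall y, `|y - x| < r -> u y - f y <= u x - f x) -> superdiff u x p.
Proof.
move=> C1 ef r0 h; exists f; split => //; first by apply/near_normP; exists r.
by have [_ ->] := expands_diff ef.
Qed.

Lemma subdiffI u x p f r : C1_near f x -> expands f x p -> 0 < r ->
  (forall y, `|y - x| < r -> u x - f x <= u y - f y) -> subdiff u x p.
Proof.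
move=> C1 ef r0 h; exists f; split => //; first by apply/near_normP; exists r.
by have [_ ->] := expands_diff ef.
Qed.

Lemma superdiff_sqr u x c a r : 0 < r ->
  (forall y, `|y - x| < r ->
    u y - c * dot (y - a) (y - a) <= u x - c * dot (x - a) (x - a)) ->
  superdiff u x ((2 * c) *: (x - a)).
Proof.
move=> r0 h; apply: (superdiffI (f := fun y => c * dot (y - a) (y - a)) _ _ r0 h).
  exact: C1_near_sqr.
exact: expands_sqr.
Qed.

Lemma subdiff_C1 u x p : C1_near u x -> expands u x p -> subdiff u x p.
Proof.
by move=> C1 eu; apply: (subdiffI C1 eu (@ltr01 _)) => y _; rewrite !subrr.
Qed.

(** Lowering a function while keeping its value at [x] can only enlarge its
    superdifferential there. *)
Lemma superdiff_le u v x p r : 0 < r -> (forall y, `|y - x| < r -> v y <= u y) ->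
  v x = u x -> superdiff u x p -> superdiff v x p.
Proof.
move=> r0 vu e /superdiff_touch [f [C1 ef [s s0 h]]].
apply: (superdiffI (r := Num.min r s) C1 ef); first by rewrite lt_min r0.
by move=> y; rewrite lt_min => /andP [/vu h1 /h h2]; rewrite e; lra.
Qed.

Lemma subdiff_le u v x p r : 0 < r -> (forall y, `|y - x| < r -> u y <= v y) ->
  v x = u x -> subdiff u x p -> subdiff v x p.
Proof.
move=> r0 vu e /subdiff_touch [f [C1 ef [s s0 h]]].
apply: (subdiffI (r := Num.min r s) C1 ef); first by rewrite lt_min r0.
by move=> y; rewrite lt_min => /andP [/vu h1 /h h2]; rewrite e; lra.
Qed.

Lemma superdiff_shift f a x p :
  superdiff (fun y => f (y + a)) x p -> superdiff f (x + a) p.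
Proof.
move=> /superdiff_touch [g [C1 eg [r r0 h]]].
apply: (superdiffI (f := fun y => g (y - a)) (r := r) _ _ r0).
- by apply: C1_near_shift; rewrite addrK; exact: C1.
- by apply: expands_shift; rewrite addrK; exact: eg.
- move=> y yr; have := h (y - a); rewrite subrK addrK; apply.
  by rewrite -addrA -opprD (addrC a).
Qed.

Lemma subdiff_shift f a x p :
  subdiff (fun y => f (y + a)) x p -> subdiff f (x + a) p.
Proof.
move=> /subdiff_touch [g [C1 eg [r r0 h]]].
apply: (subdiffI (f := fun y => g (y - a)) (r := r) _ _ r0).
- by apply: C1_near_shift; rewrite addrK; exact: C1.
- by apply: expands_shift; rewrite addrK; exact: eg.
- move=> y yr; have := h (y - a); rewrite subrK addrK; apply.
  by rewrite -addrA -opprD (addrC a).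
Qed.

Lemma superdiff_opp u x p : superdiff (fun y => - u y) x p -> subdiff u x (- p).
Proof.
move=> /superdiff_touch [f [C1 ef [r r0 h]]].
apply: (subdiffI (f := fun y => - f y) _ _ r0).
- exact: C1_near_opp.
- exact: expandsN.
- by move=> y /h; lra.
Qed.

Lemma superdiff_add_sqr u c a x p :
  superdiff (fun y => u y + c * dot (y - a) (y - a)) x p ->
  superdiff u x (p - (2 * c) *: (x - a)).
Proof.
move=> /superdiff_touch [f [C1 ef [r r0 h]]].
apply: (superdiffI (f := fun y => f y + (- c) * dot (y - a) (y - a)) _ _ r0).
- exact: C1_near_add_sqr.
- apply: expandsD => //.
  by have := expands_sqr (- c) a x; rewrite mulrN scaleNr.
- by move=> y /h; lra.
Qed.

Lemma subdiff_add_sqr u c a x p : subdiff u x p ->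
  subdiff (fun y => u y + c * dot (y - a) (y - a)) x (p + (2 * c) *: (x - a)).
Proof.
move=> /subdiff_touch [f [C1 ef [r r0 h]]].
apply: (subdiffI (f := fun y => f y + c * dot (y - a) (y - a)) _ _ r0).
- exact: C1_near_add_sqr.
- by apply: expandsD => //; exact: expands_sqr.
- by move=> y /h; lra.
Qed.

Lemma small_step (e : 'rV[R]_N) r : 0 < r -> exists2 t, 0 < t &
  forall s, 0 < s < t -> `|s *: e| < r.
Proof.
move=> r0; exists (r / (`|e| + 1)); first by rewrite divr_gt0 // ltr_wpDl.
move=> s /andP [s0]; rewrite ltr_pdivlMr ?ltr_wpDl // normrZ gtr0_norm // => h.
by apply: le_lt_trans h; rewrite mulrDr mulr1 lerDl ltW.
Qed.

Lemma superdiff_slope_le u x p e s r : 0 < r -> superdiff u x p ->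
  (forall t, 0 < t < r -> u x <= u (x - t *: e) + s * t) -> dot p e <= s.
Proof.
move=> r0 /superdiff_touch [f [C1 ef [r1 r10 h]]] hs.
have [r2 r20 hr2] := small_step e r10.
rewrite -(opprK e) dotNr -dotNl.
apply: (@expands_slope_le _ _ (fun y => - f y) x _ _ _ (Num.min r r2)).
- by rewrite lt_min r0.
- exact: expandsN.
move=> t /andP [t0]; rewrite lt_min => /andP [tr tr2].
have t1 : 0 < t < r by rewrite t0.
have t2 : 0 < t < r2 by rewrite t0.
have := hs _ t1; have := h (x - t *: e); rewrite addrAC subrr add0r normrN.
by move=> /(_ (hr2 _ t2)); rewrite scalerN; lra.
Qed.

Lemma subdiff_slope_le u x p e s r : 0 < r -> subdiff u x p ->
  (forall t, 0 < t < r -> u (x + t *: e) <= u x + s * t) -> dot p e <= s.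
Proof.
move=> r0 /subdiff_touch [f [C1 ef [r1 r10 h]]] hs.
have [r2 r20 hr2] := small_step e r10.
apply: (@expands_slope_le _ _ f x _ _ _ (Num.min r r2)) => //.
  by rewrite lt_min r0.
move=> t /andP [t0]; rewrite lt_min => /andP [tr tr2].
have t1 : 0 < t < r by rewrite t0.
have t2 : 0 < t < r2 by rewrite t0.
have := hs _ t1; have := h (x + t *: e); rewrite addrAC subrr add0r.
by move=> /(_ (hr2 _ t2)); lra.
Qed.

Lemma superdiff_unique u x p q : superdiff u x p -> expands u x q -> p = q.
Proof.
move=> /superdiff_touch [f [C1 ef [r1 r10 h]]] eu.
have [r2 r20 hr2] := small_step (q - p) r10.
have : dot (q + - p) (q - p) <= 0.
  apply: (@expands_slope_le _ _ (fun y => u y + - f y) x _ _ _ r2) => //.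
    by apply: expandsD => //; exact: expandsN.
  move=> t tr; have := h (x + t *: (q - p)); rewrite addrAC subrr add0r.
  by move=> /(_ (hr2 _ tr)); lra.
move=> le; apply/esym/subr0_eq/dot_eq0/eqP.
by rewrite eq_le le dot_ge0.
Qed.

Lemma continuous_dot_sqr : continuous (fun z : 'rV[R]_N => dot z z).
Proof.
move=> z.
have -> : (fun z : 'rV[R]_N => dot z z) = (fun z => 1 * dot (z - 0) (z - 0)).
  by apply/funext => w; rewrite subr0 mul1r.
by apply: differentiable_continuous; have [] := expands_diff (expands_sqr 1 0 z).
Qed.

Lemma compact_box (y : 'rV[R]_N) r : compact [set z : 'rV[R]_N | `|z - y| <= r].
Proof.
apply: bounded_closed_compact.
  exists (`|y| + r); split; first exact: num_real.
  move=> M hM z /= zr.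
  by have := ler_normD (z - y) y; rewrite subrK; lra.
have -> : [set z : 'rV[R]_N | `|z - y| <= r] = (fun z => `|z - y|) @^-1` [set t | t <= r].
  by [].
apply: closed_comp => [z _|]; last exact: closed_le.
apply: continuous_comp; last exact: norm_continuous.
have -> : (fun z : 'rV[R]_N => z - y) = (fun z => 1 *: (z - y)).
  by apply/funext => w; rewrite scale1r.
exact: continuous_affine.
Qed.

Lemma max_on_tube (F : R * 'rV[R]_N -> R) r : 0 < r -> continuous F ->
  exists t z, [/\ 0 <= t <= 1, `|z| <= r &
    forall t' z', 0 <= t' <= 1 -> `|z'| <= r -> F (t', z') <= F (t, z)].
Proof.
move=> r0 cF.
pose K := [set t : R | 0 <= t <= 1] `*` [set z : 'rV[R]_N | `|z - 0| <= r].
have K0 : K !=set0.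
  by exists (0, 0); split => /=; rewrite ?subr0 ?normr0 ?lexx ?ler01 ?ltW.
have cK : compact K.
  apply: compact_setX; last exact: compact_box.
  have -> : [set t : R | 0 <= t <= 1] = [set` `[0, 1]].
    by apply/seteqP; split => t /=; rewrite in_itv.
  exact: segment_compact.
have cFK : {within K, continuous F} by apply: continuous_subspaceT.
have [[t z] /set_mem [/= t01 zr] h] := compact_EVT_max K0 cK cFK.
exists t, z; split => //; first by rewrite subr0 in zr.
by move=> t' z' ht hz; apply: h; apply/mem_set; split; rewrite /= ?subr0.
Qed.

(** The basic comparison.  Maximise
    [u(y + t e + z) - s' t - c |z|^2] over [t] in [[0, 1]] and small [z], for
    some [s' > s] and large [c].  At a maximum [(t0, z0)] the covector [2 c z0]
    is a superdifferential of [u], so its product with [e] is at most [s < s'];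
    sliding back along [e] would then increase the function unless [t0 = 0].
    Hence the value at [t = 1] is bounded by values of [u] near [y].  With
    [e = 0] and [s = -1] the conclusion is absurd, so the statement also says
    that superdifferentials exist on a dense set. *)
Lemma superdiff_increment u y e s rho : continuous u -> 0 < rho ->
  (forall t x q, 0 <= t <= 1 -> `|x - (y + t *: e)| < rho ->
     superdiff u x q -> dot q e <= s) ->
  u (y + e) <= u y + s.
Proof.
move=> cu rho0 hD.
apply/ler_addgt0Pr => eta' eta0'.
pose eta := eta' / 2; have eta0 : 0 < eta by rewrite divr_gt0.
have rho2 : 0 < rho / 2 by rewrite divr_gt0.
pose s' := s + eta.
have cg : continuous (fun w : R * 'rV[R]_N => u (y + w.1 *: e + w.2) - s' * w.1).
  move=> w; apply: cvgB; last by apply: cvgM; [exact: cvg_cst|exact: cvg_fst].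
  apply: continuous_comp; last exact: cu.
  apply: cvgD; last exact: cvg_snd.
  apply: cvgD; first exact: cvg_cst.
  by apply: (@cvgZr_tmp _ _ _ _ _ fst); exact: cvg_fst.
have [t1 [z1 [_ _ hM]]] := max_on_tube rho2 cg.
pose M := u (y + t1 *: e + z1) - s' * t1.
rewrite /= -/M in hM; clearbody M.
have /cont_normP /(_ _ eta0) [r' r'0 hr'] := cu y.
pose r := Num.min r' (rho / 2); have r0 : 0 < r by rewrite lt_min r'0.
have My : u y <= M.
  have := hM 0 0; rewrite /= scale0r !addr0 normr0 mulr0 subr0 lexx ler01.
  by apply => //; exact: ltW.
(* [c] is so large that the maximum point satisfies [|z0| < r]. *)
pose c := (M - u y + 1) / r ^+ 2.
have c0 : 0 < c by rewrite divr_gt0 ?exprn_gt0 // ltr_wpDl // subr_ge0.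
have crE : c * r ^+ 2 = M - u y + 1 by rewrite /c divfK // expf_neq0 // gt_eqF.
clearbody c.
have cF : continuous (fun w : R * 'rV[R]_N =>
    u (y + w.1 *: e + w.2) - s' * w.1 - c * dot w.2 w.2).
  move=> w; apply: cvgB; first exact: cg.
  apply: cvgM; first exact: cvg_cst.
  apply: (@continuous_comp _ _ _ snd (fun z : 'rV[R]_N => dot z z)).
    exact: cvg_snd.
  exact: continuous_dot_sqr.
have [t0 [z0 [t01 z0r h0]]] := max_on_tube rho2 cF.
move: h0 => /= h0.
have z0r' : `|z0| < r.
  have h1 := h0 0 0; rewrite scale0r !addr0 dot0l !mulr0 !subr0 lexx ler01 normr0 in h1.
  have {}h1 := h1 isT (ltW rho2).
  have h2 := hM t0 z0 t01 z0r.
  have h3 : c * dot z0 z0 < M - u y + 1 by lra.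
  have h4 : dot z0 z0 < r ^+ 2.
    by rewrite -(ltr_pM2l c0) crE.
  rewrite -(ltr_pXn2r (n := 2)) ?nnegrE ?normr_ge0 ?(ltW r0) //.
  exact: le_lt_trans (norm_le_dot _) h4.
have z0rho : `|z0| < rho / 2 by move: z0r'; rewrite lt_min => /andP [].
have z0r'' : `|z0| < r' by move: z0r'; rewrite lt_min => /andP [].
pose a := y + t0 *: e; pose x0 := a + z0.
have x0a : x0 - a = z0 by rewrite /x0 addrAC subrr add0r.
have sd : superdiff u x0 ((2 * c) *: (x0 - a)).
  apply: (@superdiff_sqr _ _ _ _ (rho / 2 - `|z0|)); first by rewrite subr_gt0.
  move=> x xx0.
  have := h0 t0 (x - a) t01; rewrite x0a -/a (addrC a (x - a)) subrK -/x0.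
  have : `|x - a| <= rho / 2 by have := ler_distD x0 x a; rewrite x0a; lra.
  by move=> xa /(_ xa); lra.
have dq : dot ((2 * c) *: (x0 - a)) e <= s.
  apply: (hD t0 x0) => //; rewrite -/a x0a; lra.
rewrite x0a dotZl in dq.
(* The maximum is on the initial face: compare with the endpoint [t = 1]. *)
have [t00|t0n0] := eqVneq t0 0.
  have := h0 1 0; rewrite t00 scale1r scale0r dot0l mulr0 normr0 lexx ler01 !addr0.
  rewrite mulr1 mulr0 !subr0.
  move=> /(_ isT (ltW rho2)) h1.
  have := hr' (y + z0); rewrite addrAC subrr add0r => /(_ z0r'').
  rewrite ltr_norml => /andP [_ h2].
  have : 0 <= c * dot z0 z0 by rewrite mulr_ge0 ?dot_ge0 // ltW.
  rewrite /s' /eta in h1 h2 *; lra.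
(* Otherwise move [h] backwards in [t] and compensate by [h e] in [z]: the
   argument of [u] stays the same. *)
have t0p : 0 < t0 by rewrite lt_neqAle eq_sym t0n0; case/andP: t01.
have [r1 r10 hr1] := @small_step e (rho / 2 - `|z0|) ltac:(by rewrite subr_gt0).
pose h := Num.min (Num.min t0 (r1 / 2)) (eta / 2 / (c * dot e e + 1)).
have ce0 : 0 < c * dot e e + 1 by rewrite ltr_wpDl // mulr_ge0 ?dot_ge0 // ltW.
have hp : 0 < h by rewrite !lt_min t0p !divr_gt0.
have ht0 : h <= t0 by rewrite !ge_min lexx.
have hr1' : h < r1 by rewrite !gt_min [r1 / 2 < _]ltr_pdivrMr // ltr_pMr // ltr1n orbT.
have heta : h * (c * dot e e + 1) <= eta / 2.
  by rewrite -ler_pdivlMr // ge_min lexx orbT.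
have := h0 (t0 - h) (z0 + h *: e).
have -> : y + (t0 - h) *: e + (z0 + h *: e) = x0.
  by rewrite scalerBl /x0 /a [z0 + _]addrC !addrA subrK.
have -> : y + t0 *: e + z0 = x0 by [].
have t0h : 0 <= t0 - h <= 1.
  by case/andP: t01 => _ t1'; rewrite subr_ge0 ht0 /=; lra.
have zh : `|z0 + h *: e| <= rho / 2.
  have := hr1 h; rewrite hp hr1' => /(_ isT); have := ler_normD z0 (h *: e); lra.
move=> /(_ t0h zh).
rewrite dotDl !dotDr !dotZl !dotZr (dotC e z0) => h1.
have h2 : s' * h <= h * (2 * c * dot z0 e) + h * (h * (c * dot e e)) by lra.
have h3 : h * (2 * c * dot z0 e) <= h * s by rewrite ler_pM2l.
have h4 : h * (h * (c * dot e e)) <= h * (eta / 2).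
  by rewrite ler_pM2l //; apply: le_trans heta; rewrite ler_pM2l // lerDl.
have : 0 < h * eta by rewrite mulr_gt0.
rewrite /s' in h2; lra.
Qed.

End Semidifferentials.

Section MoreSemidifferentials.
Variables (R : realType) (N : nat).
Implicit Types (u : 'rV[R]_N -> R) (x y z p a : 'rV[R]_N) (c r : R).

Lemma superdiff_addc u c x p : superdiff (fun z => u z + c) x p -> superdiff u x p.
Proof.
move=> /superdiff_touch [f [C1 ef [r r0 h]]].
by apply: (superdiffI C1 ef r0) => z /h; lra.
Qed.

Lemma subdiff_addc u c x p : subdiff u x p -> subdiff (fun z => u z + c) x p.
Proof.
move=> /subdiff_touch [f [C1 ef [r r0 h]]].
by apply: (subdiffI C1 ef r0) => z /h; lra.
Qed.

Lemma subdiff_unshift u a x p : subdiff u (x + a) p -> subdiff (fun z => u (z + a)) x p.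
Proof.
move=> h; rewrite -[x](addrK a); apply: subdiff_shift.
have -> // : (fun z => u (z - a + a)) = u by apply/funext => z; rewrite subrK.
Qed.

(** Apply [superdiff_increment] to [- u] with zero direction and increment
    [-1]. *)
Lemma subdiff_dense u y r : continuous u -> 0 < r ->
  exists z p, `|z - y| < r /\ subdiff u z p.
Proof.
move=> cu r0; apply: contrapT => h.
have : - u (y + 0) <= - u y + -1.
  apply: (@superdiff_increment _ _ (fun z => - u z) y 0 (-1) r) => //.
    by move=> z; apply: continuousN; exact: cu.
  move=> t x q _; rewrite scaler0 addr0 => xr /superdiff_opp sq.
  by exfalso; apply: h; exists x, (- q).
by rewrite addr0; lra.
Qed.

End MoreSemidifferentials.

(** * Compactness and periodicity *)

Lemma compact_unif_cont (R : realType) (V : normedModType R) (f : V -> R)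
    (K : set V) (eta : R) : compact K -> continuous f -> 0 < eta ->
  exists2 r : R, 0 < r &
    forall a b, K a -> `|b - a| < r -> `|f b - f a| < eta.
Proof.
move=> /compact_near_coveringP cK cf e0.
have e2 : 0 < eta / 2 by rewrite divr_gt0.
have /near_normP [r r0 hr] : \forall h \near (0 : V), K `<=` (fun a => `|f (a + h) - f a| < eta).
  apply: (cK V (nbhs (0 : V)) (fun h a => `|f (a + h) - f a| < eta)) => a Ka.
  have /cont_normP /(_ _ e2) [r r0 hr] := cf a.
  have r2 : 0 < r / 2 by rewrite divr_gt0.
  exists ([set a' | `|a' - a| < r / 2], [set h | `|h| < r / 2]).
    split; apply/near_normP; exists (r / 2) => // z; rewrite ?subr0 //.
  move=> [a' h] [/= ha hh].
  have h1 := hr a'; have h2 := hr (a' + h).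
  have : `|a' + h - a| < r.
    by have := ler_normD (a' - a) h; rewrite addrAC; lra.
  move=> /h2; have : `|a' - a| < r by lra.
  move=> /h1; have := ler_distD (f a) (f (a' + h)) (f a').
  by rewrite (distrC (f a) (f a')); lra.
exists r => // a b Ka ba; have := hr (b - a); rewrite subr0 => /(_ ba _ Ka).
by rewrite (addrC a (b - a)) subrK.
Qed.

Section Representative.
Variables (R : realType) (N : nat).
Implicit Types (x y : 'rV[R]_N).

(** The integer translation that brings [x] within [1/2] of [y] in every
    coordinate; [rep y x] is the representative of [x] in the corresponding
    half-open unit cube centred at [y]. *)
Definition near_rep y x : 'rV[int]_N :=
  \row_k - Num.floor (x ord0 k - y ord0 k + 2^-1).

Definition rep y x : 'rV[R]_N := x + map_mx intr (near_rep y x).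

Lemma rep_near y x : `|rep y x - y| <= 2^-1.
Proof.
apply: norm_le_coord => // k; rewrite !mxE mulrNz.
have := floor_itv (x ord0 k - y ord0 k + 2^-1); rewrite intrD.
by move=> h; rewrite ler_norml; lra.
Qed.

Lemma rep_id y x : `|x - y| < 2^-1 -> rep y x = x.
Proof.
move=> h; apply/rowP => k; rewrite !mxE.
rewrite (@floor_def _ _ 0) ?oppr0 ?addr0 //.
have := coord_le_norm (x - y) k; rewrite !mxE => h1.
have /ltr_normlP [h2 h3] := le_lt_trans h1 h.
by rewrite add0r; lra.
Qed.

Lemma rep_shift y x (k : 'rV[int]_N) : rep y (x + map_mx intr k) = rep y x.
Proof.
apply/rowP => i; rewrite !mxE.
have -> : x ord0 i + (k ord0 i)%:~R - y ord0 i + 2^-1 =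
  (x ord0 i - y ord0 i + 2^-1) + (k ord0 i)%:~R by ring.
by rewrite floorDrz ?intr_int // intrKfloor opprD intrD !mulrNz; ring.
Qed.

Lemma rep_fun (T : Type) (f : 'rV[R]_N -> T) y x : torus_fun f -> f (rep y x) = f x.
Proof. by move=> pf; rewrite /rep pf. Qed.

Lemma periodic_bounded (f : 'rV[R]_N -> R) : torus_fun f -> continuous f ->
  exists2 M : R, 0 < M & forall x, `|f x| <= M.
Proof.
move=> pf cf.
have K0 : [set z : 'rV[R]_N | `|z - 0| <= 2^-1] !=set0.
  by exists 0; rewrite /= subrr normr0.
have cnf : continuous (fun x => `|f x|).
  move=> x; apply: continuous_comp; first exact: cf.
  exact: norm_continuous.
have [z _ hz] := compact_EVT_max K0 (@compact_box R N 0 2^-1) (continuous_subspaceT cnf).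
exists (`|f z| + 1); first by rewrite ltr_wpDl.
move=> x; rewrite -(rep_fun 0 x pf).
by have := hz (rep 0 x) (mem_set (rep_near 0 x)); lra.
Qed.

Lemma periodic_unif_cont (f : 'rV[R]_N -> R) (eta : R) : torus_fun f ->
  continuous f -> 0 < eta ->
  exists2 r, 0 < r & forall x y, `|y - x| < r -> `|f y - f x| < eta.
Proof.
move=> pf cf e0.
have [r r0 hr] := compact_unif_cont (@compact_box R N 0 2^-1) cf e0.
exists r => // x y yx.
have := hr (rep 0 x) (y + map_mx intr (near_rep 0 x)) (rep_near 0 x).
by rewrite pf (rep_fun 0 x pf) /rep opprD addrACA subrr addr0 => /(_ yx).
Qed.

End Representative.

(** * Convex Hamiltonians *)

Section Hamiltonian.
Variables (R : realType) (N : nat) (H : 'rV[R]_N -> 'rV[R]_N -> R).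
Hypothesis hH : convex_hamiltonian H.
Implicit Types (x y p q e : 'rV[R]_N) (M r s t eta : R).

Let HT := fun z : 'rV[R]_N * 'rV[R]_N => H z.1 z.2.

Lemma ham_cont : continuous HT. Proof. by case: hH. Qed.

Lemma ham_per p : torus_fun (fun x => H x p).
Proof. by case: hH => _ h _ _ x k; rewrite /= h. Qed.

Lemma ham_convex x p q t : 0 <= t -> t <= 1 ->
  H x (t *: p + (1 - t) *: q) <= t * H x p + (1 - t) * H x q.
Proof.
move=> t0 t1; case: hH => _ _ /(_ x) h _.
exact: (h (Itv01 t0 t1) p q (mem_set I) (mem_set I)).
Qed.

Lemma norm_le_enorm p : `|p| <= enorm p.
Proof.
have -> : enorm p = Num.sqrt (dot p p).
  by rewrite /enorm; congr Num.sqrt; apply: eq_bigr => k _; rewrite expr2.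
have := ler_wsqrtr (norm_le_dot p).
by rewrite sqrtr_sqr ger0_norm.
Qed.

Lemma ham_coercive M : exists2 K, 0 < K & forall x p, H x p <= M -> `|p| <= K.
Proof.
case: hH => _ _ _ [al [be [/cvgryPgt /(_ M) [K [_ hK]] _ hab]]].
exists (`|K| + 1); first by rewrite ltr_wpDl.
move=> x p hM; rewrite leNgt; apply/negP => h.
have : K < enorm p.
  by have := norm_le_enorm p; have := ler_norm K; lra.
by move=> /hK /= h1; have /andP [h2 _] := hab x p; lra.
Qed.

(** Periodicity in [x] makes the continuity of [H] uniform in [x] as long as
    the covector stays bounded. *)
Lemma ham_unif K eta : 0 < eta -> exists2 r, 0 < r &
  forall x x' p p', `|x' - x| < r -> `|p' - p| < r -> `|p| <= K ->
    `|H x' p' - H x p| < eta.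
Proof.
move=> e0.
have cK : compact ([set z : 'rV[R]_N | `|z - 0| <= 2^-1] `*`
                   [set z : 'rV[R]_N | `|z - 0| <= K]).
  by apply: compact_setX; exact: compact_box.
have [r r0 hr] := compact_unif_cont cK ham_cont e0.
exists r => // x x' p p' xx pp pK.
have := hr (rep 0 x, p) (x' + map_mx intr (near_rep 0 x), p').
rewrite /HT /= ham_per (rep_fun 0 x (ham_per p)); apply.
  by split; rewrite /= ?subr0 //; have := rep_near 0 x; rewrite subr0.
rewrite prod_normE /= gt_max pp andbT.
by rewrite /rep opprD addrACA subrr addr0.
Qed.

Lemma ham_below : exists m, forall x p, m <= H x p.
Proof.
have [K K0 hK] := ham_coercive 0.
have cK : compact ([set z : 'rV[R]_N | `|z - 0| <= 2^-1] `*`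
                   [set z : 'rV[R]_N | `|z - 0| <= K]).
  by apply: compact_setX; exact: compact_box.
have K0' : ([set z : 'rV[R]_N | `|z - 0| <= 2^-1] `*`
                   [set z : 'rV[R]_N | `|z - 0| <= K]) !=set0.
  by exists (0, 0); split; rewrite /= subrr normr0 // ltW.
have [z _ hz] := compact_EVT_min K0' cK (continuous_subspaceT ham_cont).
exists (Num.min 0 (HT z)) => x p.
have [h|h] := leP (H x p) 0; last by rewrite ge_min ltW.
have := hz (rep 0 x, p); rewrite /HT /= (rep_fun 0 x (ham_per p)) => h1.
rewrite ge_min h1 ?orbT //; apply/mem_set; split => /=.
  exact: rep_near.
by rewrite subr0; exact: hK h.
Qed.

Lemma ham_sublevel_compact x M : compact [set q | H x q <= M].
Proof.
have [K K0 hK] := ham_coercive M.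
apply: bounded_closed_compact.
  exists K; split; first exact: num_real.
  by move=> M' hM q /= /hK; lra.
have -> : [set q | H x q <= M] = (H x) @^-1` [set t | t <= M] by [].
apply: closed_comp => [q _|]; last exact: closed_le.
apply/cont_normP => eta e0; have [r r0 hr] := ham_unif `|q| e0.
by exists r => // q' hq; apply: hr; rewrite // subrr normr0.
Qed.

(** The covector [e] is [p - c], where [c] is the point of the compact convex
    sublevel nearest to [p].  If the sublevel is empty, [e = 0] and [s = -1]
    express it. *)
Lemma ham_separation x p M : M < H x p -> exists e s,
  s < dot p e /\ forall q, H x q <= M -> dot q e <= s.
Proof.
move=> hM.
have [[q0 hq0]|C0] := pselect ([set q | H x q <= M] !=set0); last first.
  exists 0, (-1); rewrite dot0r ltrN10; split => // q hq.
  by exfalso; apply: C0; exists q.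
have cd : continuous (fun q : 'rV[R]_N => dot (q - p) (q - p)).
  move=> q; have := differentiable_continuous
    (proj1 (expands_diff (expands_sqr 1 p q))).
  by under [X in {for _, continuous X} -> _]eq_fun do rewrite mul1r.
have [c /set_mem /= hc hmin] := compact_EVT_min (ex_intro _ q0 hq0)
  (ham_sublevel_compact (x := x) (M := M)) (continuous_subspaceT cd).
have pc : 0 < dot (p - c) (p - c).
  rewrite lt_neqAle dot_ge0 andbT eq_sym; apply/eqP => /dot_eq0 /subr0_eq e.
  by move: hM; rewrite e; lra.
exists (p - c), (dot c (p - c)); split.
  by move: pc; rewrite {1}dotDl dotNl; lra.
move=> q hq; rewrite leNgt; apply/negP => lt.
pose d := dot (q - c) (p - c).
have d0 : 0 < d by rewrite /d dotDl dotNl; lra.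
pose D := dot (q - c) (q - c).
have D0 : 0 <= D by exact: dot_ge0.
(* Moving from [c] towards [q] by [t] would come closer to [p]. *)
pose t := Num.min 1 (d / (D + 1)).
have t0 : 0 < t by rewrite lt_min ltr01 divr_gt0 // ltr_wpDl.
have t1 : t <= 1 by rewrite ge_min lexx.
have tD : t * D < 2 * d.
  have : t * (D + 1) <= d by rewrite -ler_pdivlMr ?ltr_wpDl // ge_min lexx orbT.
  lra.
have hqt : H x (t *: q + (1 - t) *: c) <= M.
  apply: le_trans (ham_convex _ _ _ (ltW t0) t1) _.
  have : t * H x q <= t * M by rewrite ler_wpM2l // ltW.
  have : (1 - t) * H x c <= (1 - t) * M by rewrite ler_wpM2l // subr_ge0.
  lra.
have := hmin _ (mem_set hqt).
have -> : t *: q + (1 - t) *: c - p = - (p - c) + t *: (q - c).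
  apply/rowP => k; rewrite !mxE; ring.
have -> : c - p = - (p - c) by rewrite opprB.
rewrite !(dotDl, dotDr (- (p - c)), dotDr (t *: (q - c))).
rewrite (dotNl (p - c) (t *: (q - c))) (dotNr (p - c) (t *: (q - c))).
rewrite !dotZl !dotZr (dotC (p - c) (q - c)) -/d -/D => h.
have : t * (t * D) < t * (2 * d) by rewrite ltr_pM2l.
lra.
Qed.

(** The separating half-space still contains the slightly smaller sublevels at
    nearby points, since [H] is uniformly continuous on the bounded set where
    those sublevels live. *)
Lemma ham_support x p M M' : M < M' -> M' <= H x p -> exists e s r,
  [/\ s < dot p e, 0 < r &
    forall x' q, `|x' - x| < r -> H x' q <= M -> dot q e <= s].
Proof.
move=> MM hM.
pose eta := (M' - M) / 2.
have e0 : 0 < eta by rewrite divr_gt0 // subr_gt0.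
have [K K0 hK] := ham_coercive M.
have [r r0 hr] := ham_unif K e0.
have [e [s [h1 h2]]] : exists e s, s < dot p e /\
    forall q, H x q <= M + eta -> dot q e <= s.
  by apply: ham_separation; rewrite /eta; lra.
exists e, s, r; split => // x' q xr hq; apply: h2.
have := hr x' x q q; rewrite subrr normr0 distrC => /(_ xr r0 (hK _ _ hq)).
by rewrite ltr_norml => /andP [_]; lra.
Qed.

(** Convexity of [H] is what makes a subsolution inequality hold on
    subdifferentials.  A half-space separating [p] from the sublevel contains
    all superdifferentials of [u] near [x0], so it bounds the increments of
    [u] from [x0]; a function touching from below at [x0] cannot grow faster. *)
Lemma subdiff_subsolution u (g : 'rV[R]_N -> R) x0 rho : continuous u ->
  {for x0, continuous g} -> 0 < rho ->
  (forall x q, `|x - x0| < rho -> superdiff u x q -> H x q <= g x) ->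
  forall p, subdiff u x0 p -> H x0 p <= g x0.
Proof.
move=> cu cg rho0 hD p sp; rewrite leNgt; apply/negP => lt.
pose eta := (H x0 p - g x0) / 2.
have e0 : 0 < eta by rewrite divr_gt0 // subr_gt0.
have [e [s [r [se r0 hr]]]] : exists e s r, [/\ s < dot p e, 0 < r &
    forall x' q, `|x' - x0| < r -> H x' q <= g x0 + eta -> dot q e <= s].
  by apply: ham_support (lexx _); rewrite /eta; lra.
have /cont_normP /(_ _ e0) [r1 r10 hr1] := cg.
pose r2 := Num.min rho (Num.min r r1) / 2.
have r20 : 0 < r2 by rewrite divr_gt0 // !lt_min rho0 r0.
have r2E : r2 * 2 = Num.min rho (Num.min r r1) by rewrite divfK.
have [t1 t10 ht1] := small_step e r20.
suff : dot p e <= s by lra.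
apply: (subdiff_slope_le t10 sp) => t tt; apply: (superdiff_increment (rho := r2) cu) => //.
move=> t' x q t'01 xr sq.
have xx0 : `|x - x0| < Num.min rho (Num.min r r1).
  rewrite -r2E; have := ler_normD (x - (x0 + t' *: (t *: e))) (t' *: (t *: e)).
  have -> : x - (x0 + t' *: (t *: e)) + t' *: (t *: e) = x - x0.
    by rewrite opprD addrA subrK.
  have : `|t' *: (t *: e)| <= `|t *: e|.
    case/andP: t'01 => a b; rewrite normrZ ger0_norm //.
    by rewrite ler_piMl.
  have := ht1 _ tt; lra.
move: xx0; rewrite !lt_min => /and3P [x1 x2 x3].
rewrite dotZr mulrC ler_pM2r; last by case/andP: tt.
apply: hr (x2) _; apply: le_trans (hD _ _ x1 sq) _.
by have := hr1 _ x3; rewrite ltr_norml => /andP [_]; lra.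
Qed.

End Hamiltonian.

(** * A priori bounds for subsolutions of the coupled system *)

Lemma fin_bound (R : realType) (I : finType) (P : I -> R -> Prop) :
  (forall i M M', M <= M' -> P i M -> P i M') -> (forall i, exists M, P i M) ->
  exists2 M : R, 0 < M & forall i, P i M.
Proof.
move=> mono /choice [f hf]; exists (\sum_i `|f i| + 1).
  by rewrite ltr_wpDl // sumr_ge0.
move=> i; apply: mono (hf i); rewrite (bigD1 i) //= -addrA.
apply: le_trans (ler_norm _) _; rewrite lerDl addr_ge0 // sumr_ge0 //.
Qed.

Lemma fin_radius (R : realType) (I : finType) (P : I -> R -> Prop) :
  (forall i r r', r' <= r -> P i r -> P i r') ->
  (forall i, exists2 r : R, 0 < r & P i r) -> exists2 r : R, 0 < r & forall i, P i r.
Proof.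
move=> mono hP.
have [M M0 hM] : exists2 M : R, 0 < M & forall i, (fun i M => 0 < M /\ P i M^-1) i M.
  apply: fin_bound => [i M M' MM [M0 h]|i].
    have M'0 : 0 < M' by exact: lt_le_trans MM.
    by split => //; apply: mono h; rewrite lef_pV2.
  by have [r r0 h] := hP i; exists r^-1; rewrite invr_gt0 invrK.
by exists M^-1 => [|i]; [rewrite invr_gt0|case: (hM i)].
Qed.

Lemma continuous_at_mul (R : realType) (V : normedModType R) (f g : V -> R) (x : V) :
  {for x, continuous f} -> {for x, continuous g} ->
  {for x, continuous (fun z => f z * g z)}.
Proof. by move=> cf cg; exact: (@cvgM _ _ _ _ f g). Qed.

Lemma continuous_at_add (R : realType) (V : normedModType R) (f g : V -> R) (x : V) :
  {for x, continuous f} -> {for x, continuous g} ->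
  {for x, continuous (fun z => f z + g z)}.
Proof. by move=> cf cg; exact: (@cvgD _ _ _ _ _ f g). Qed.

Lemma continuous_sum_ord (R : realType) (V : normedModType R) n (f : 'I_n -> V -> R) x :
  (forall i, {for x, continuous (f i)}) ->
  {for x, continuous (fun z => \sum_(i < n) f i z)}.
Proof.
move=> cf; elim: n f cf => [|n IH] f cf.
  have -> : (fun z => \sum_(i < 0) f i z) = fun=> 0.
    by apply/funext => z; rewrite big_ord0.
  exact: cst_continuous.
have -> : (fun z => \sum_(i < n.+1) f i z) =
    (fun z => \sum_(i < n) f (widen_ord (leqnSn n) i) z) + f ord_max.
  by apply/funext => z; rewrite big_ord_recr.
by apply: continuousD; [apply: IH => i; exact: cf|exact: cf].
Qed.

Lemma superdiff_periodic (R : realType) (N : nat) (u : 'rV[R]_N -> R) x p k :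
  torus_fun u -> superdiff u x p -> superdiff u (x + map_mx intr k) p.
Proof.
move=> pu sp; apply: superdiff_shift.
by have -> : (fun y => u (y + map_mx intr k)) = u by apply/funext => z; rewrite pu.
Qed.

Lemma subdiff_periodic (R : realType) (N : nat) (u : 'rV[R]_N -> R) x p k :
  torus_fun u -> subdiff u x p -> subdiff u (x + map_mx intr k) p.
Proof.
move=> pu sp; apply: subdiff_shift.
by have -> : (fun y => u (y + map_mx intr k)) = u by apply/funext => z; rewrite pu.
Qed.

Section System.
Variables (R : realType) (N m : nat).
Variables (H : 'I_m -> 'rV[R]_N -> 'rV[R]_N -> R) (B : 'rV[R]_N -> 'M[R]_m).
Hypothesis hH : forall i, convex_hamiltonian (H i).
Hypothesis hBcont : forall i j, continuous (fun x => B x i j).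
Hypothesis hBper : torus_fun B.
Hypothesis hBdeg : forall x, degenerate_coupling_matrix (B x).
Hypothesis hBirr : forall x, irreducible_matrix (B x).
Implicit Types (u v w : 'I_m -> 'rV[R]_N -> R) (x y z p q e : 'rV[R]_N).
Implicit Types (a c r s t eta : R) (i j k : 'I_m).

Lemma B_off x i j : j != i -> B x i j <= 0.
Proof. by case: (hBdeg x) => -[h _] _; exact: h. Qed.

Lemma B_sum0 x i : \sum_j B x i j = 0.
Proof. by case: (hBdeg x). Qed.

Lemma B_diag x i : 0 <= B x i i.
Proof.
have := B_sum0 x i; rewrite (bigD1 i) //= => /eqP; rewrite addr_eq0 => /eqP ->.
rewrite -sumrN; apply: sumr_ge0 => j ji; rewrite oppr_ge0; exact: B_off.
Qed.

Lemma B_bounded : exists2 b : R, 0 < b & forall x i j, `|B x i j| <= b.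
Proof.
have [b b0 hb] : exists2 M : R, 0 < M & forall ij : 'I_m * 'I_m,
    (fun ij M => forall x, `|B x ij.1 ij.2| <= M) ij M.
  apply: fin_bound => [ij M M' MM h x|[i j]]; first exact: le_trans (h x) MM.
  have [] := @periodic_bounded R N (fun x => B x i j); last by move=> M; exists M.
    by move=> x k; rewrite hBper.
  exact: hBcont.
by exists b => // x i j; exact: (hb (i, j)).
Qed.

Lemma coercive_all a : exists2 K : R, 0 < K & forall i x p, H i x p <= a -> `|p| <= K.
Proof.
apply: (@fin_bound R _ (fun i K => forall x p, H i x p <= a -> `|p| <= K)).
  by move=> i M M' MM h x p /h /le_trans; exact.
by move=> i; have [K _ h] := ham_coercive (hH i) a; exists K.
Qed.

Lemma below_all : exists2 M : R, 0 < M & forall i x p, - M <= H i x p.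
Proof.
apply: (@fin_bound R _ (fun i M => forall x p, - M <= H i x p)).
  by move=> i M M' MM h x p; apply: le_trans (h x p); rewrite lerN2.
by move=> i; have [M h] := ham_below (hH i); exists (- M) => x p; rewrite opprK.
Qed.

Lemma coupling_cst v c x i :
  coupling_term B (fun j z => v j z + c) x i = coupling_term B v x i.
Proof.
rewrite /coupling_term; under eq_bigr do rewrite mulrDr.
by rewrite big_split /= -mulr_suml B_sum0 mul0r addr0.
Qed.

(** Degeneracy makes the coupling term depend on the differences of components
    only. *)
Lemma coupling_rel v x i :
  coupling_term B v x i = \sum_j B x i j * (v j x - v i x).
Proof. by rewrite -(coupling_cst v (- v i x)). Qed.

(** Off-diagonal coefficients are nonpositive: raising the other components
    lowers the coupling term of the [i]-th one. *)
Lemma coupling_le u v x i : (forall j, j != i -> u j x <= v j x) ->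
  coupling_term B v x i <= coupling_term B u x i + B x i i * (v i x - u i x).
Proof.
move=> uv; rewrite /coupling_term (bigD1 i) //= [in leRHS](bigD1 i) //=.
have : \sum_(j < m | j != i) B x i j * v j x <= \sum_(j < m | j != i) B x i j * u j x.
  by apply: ler_sum => j ji; apply: ler_wnM2l; [exact: B_off|exact: uv].
by rewrite mulrBr; lra.
Qed.

Lemma coupling_per v x i (k : 'rV[int]_N) : (forall j, torus_fun (v j)) ->
  coupling_term B v (x + map_mx intr k) i = coupling_term B v x i.
Proof. by move=> pv; apply: eq_bigr => j _; rewrite hBper pv. Qed.

Lemma coupling_cont v i : (forall j, continuous (v j)) ->
  continuous (fun x => coupling_term B v x i).
Proof.
move=> cv x; apply: continuous_sum_ord => j.
by apply: continuous_at_mul; [exact: hBcont|exact: cv].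
Qed.

Lemma subsolution_level a a' v : a <= a' -> subsolution H B a v -> subsolution H B a' v.
Proof. by move=> aa [cv h]; split => // x i p /h /le_trans; exact. Qed.

Lemma subsolution_cst a v c : subsolution H B a v ->
  subsolution H B a (fun j z => v j z + c).
Proof.
move=> [cv h]; split.
  move=> i; have [c1 p1] := cv i; split; last by move=> x k; rewrite p1.
  by move=> x; apply: continuous_at_add; [exact: c1|exact: cst_continuous].
move=> x i p sp; rewrite coupling_cst; apply: h.
have [f [C1 ef [r r0 hr]]] := superdiff_touch sp.
by apply: superdiffI C1 ef r0 _ => z /hr; lra.
Qed.

(** A maximum principle: if all coupling terms of [w] were nonpositive, then
    the set of indices where [w] is maximal would violate irreducibility. *)
Lemma irreducible_pos x (w : 'I_m -> R) i j : w i = 1 -> w j = 0 ->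
  (forall k, w k <= 1) -> exists k, 0 < \sum_l B x k l * w l.
Proof.
move=> wi wj w1.
pose I := [set k | w k == 1]%SET.
have iI : i \in I by rewrite inE wi.
have jI : j \notin I by rewrite inE wj eq_sym oner_eq0.
have [||k [l [kI lI kl]]] := @hBirr x I.
- by apply/set0Pn; exists i.
- by apply/properP; split; [exact: finset.subsetT|exists j].
exists k; have lk : l != k by apply: contraNneq lI => ->.
have -> : \sum_l B x k l * w l = \sum_l B x k l * (w l - 1).
  under [RHS]eq_bigr do rewrite mulrBr mulr1.
  by rewrite big_split /= sumrN B_sum0 subr0.
have wk : w k = 1 by move: kI; rewrite inE => /eqP.
have wl : w l < 1 by rewrite lt_neqAle w1 andbT; move: lI; rewrite inE.
rewrite (bigD1 l) //= ltr_wpDr //.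
  apply: sumr_ge0 => n _; have [->|nk] := eqVneq n k.
    by rewrite wk subrr mulr0.
  by rewrite mulr_le0 ?subr_le0 // B_off.
by rewrite nmulr_rgt0 ?subr_lt0 // lt_neqAle kl B_off.
Qed.

Let osc_itv i j k : set R :=
  if k == i then [set 1] else if k == j then [set 0] else [set` `[0, 1]].

(** Normalised vectors with maximum [1] at [i] and minimum [0] at [j], together
    with a base point in a fundamental cube: a compact set. *)
Let osc_set i j : set ('rV[R]_N * 'rV[R]_m) :=
  [set z : 'rV[R]_N | `|z - 0| <= 2^-1] `*`
  [set w : 'rV[R]_m | forall k, osc_itv i j k (w ord0 k)].

(** A continuous substitute for the largest coupling term, positive on
    [osc_set i j] by irreducibility. *)
Let pospart (z : 'rV[R]_N * 'rV[R]_m) : R :=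
  \sum_k Num.max 0 (\sum_l B z.1 k l * z.2 ord0 l).

Let pospart_ge0 (z : 'rV[R]_N * 'rV[R]_m) : 0 <= pospart z.
Proof. by apply: sumr_ge0 => k _; rewrite le_max lexx. Qed.

Let pospart_cont : continuous pospart.
Proof.
move=> z; apply: continuous_sum_ord => k.
apply: (@continuous_comp _ _ _ _ (fun t : R => Num.max 0 t)).
  apply: continuous_sum_ord => l; apply: cvgM.
    by apply: (@continuous_comp _ _ _ fst (fun x => B x k l)); [exact: cvg_fst|exact: hBcont].
  apply: (@continuous_comp _ _ _ snd (fun w : 'rV[R]_m => w ord0 l)); first exact: cvg_snd.
  exact: coord_continuous.
have -> : (fun t : R => Num.max 0 t) = (fun t => (t + `|t|) / 2).
  apply/funext => t; have [t0|t0] := leP 0 t.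
    by rewrite ger0_norm //; lra.
  by rewrite ltr0_norm //; lra.
move=> t; apply: cvgM; last exact: cvg_cst.
by apply: cvgD; [exact: cvg_id|exact: norm_continuous].
Qed.

Let osc_lower i j : i != j -> exists M, forall z : 'rV[R]_N * 'rV[R]_m, osc_set i j z -> 1 <= M * pospart z.
Proof.
move=> ij.
have cK : compact (osc_set i j).
  apply: compact_setX; first exact: compact_box.
  apply: (@rV_compact _ _ (osc_itv i j)) => k; rewrite /osc_itv.
  by case: ifP => _; [exact: compact_set1|case: ifP => _;
    [exact: compact_set1|exact: segment_compact]].
have K0 : osc_set i j !=set0.
  exists (0, delta_mx ord0 i); split; first by rewrite /= subrr normr0.
  move=> k /=; rewrite /osc_itv mxE eqxx /=; case: eqP => // _.
  by case: eqP => // _; rewrite /= in_itv /= lexx ler01.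
have [z /set_mem zK hz] := compact_EVT_min K0 cK (continuous_subspaceT pospart_cont).
have zp : 0 < pospart z.
  case: (zK) => _ hw.
  have [k hk] := @irreducible_pos z.1 (z.2 ord0) i j
    ltac:(by have := hw i; rewrite /osc_itv eqxx)
    ltac:(by have := hw j; rewrite /osc_itv eq_sym (negPf ij) eqxx)
    ltac:(by move=> k; have := hw k; rewrite /osc_itv; case: ifP => _; [move=> /= ->|case: ifP => _ /=;
       [move=> ->|rewrite in_itv => /andP []]]).
  rewrite /pospart (bigD1 k) //= ltr_wpDr ?lt_max ?hk ?orbT //.
  by apply: sumr_ge0 => l _; rewrite le_max lexx.
exists (pospart z)^-1 => z' z'K.
by rewrite mulrC ler_pdivlMr // mul1r; exact: hz (mem_set z'K).
Qed.

(** By homogeneity a vector with large oscillation would, once normalised, have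
    a small value of [pospart], which is bounded below on the compact sets
    [osc_set i j]. *)
Lemma osc_bound c : exists2 C : R, 0 < C & forall x (w : 'I_m -> R),
  (forall i, \sum_j B x i j * w j <= c) -> forall i j, w i - w j <= C.
Proof.
have [M M0 hM] : exists2 M : R, 0 < M & forall ij : 'I_m * 'I_m,
    (fun ij M => ij.1 != ij.2 -> forall z : 'rV[R]_N * 'rV[R]_m, osc_set ij.1 ij.2 z -> 1 <= M * pospart z) ij M.
  apply: fin_bound => [ij M M' MM h hij z hz|[i j]].
    by apply: le_trans (h hij z hz) _; rewrite ler_wpM2r.
  have [->|ij] := eqVneq i j; first by exists 0 => /eqP [].
  by have [M h] := osc_lower ij; exists M => _.
exists (M * (m%:R * `|c|) + 1); first by rewrite ltr_wpDl // !mulr_ge0 // ltW.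
move=> x w hw i0 j0.
case: (@Order.TotalTheory.arg_maxP _ _ _ i0 predT w isT) => i _ hi.
case: (@Order.TotalTheory.arg_minP _ _ _ i0 predT w isT) => j _ hj.
have : w i0 - w j0 <= w i - w j by apply: lerB; [exact: hi|exact: hj].
move=> /le_trans; apply.
have [d0|d0] := leP (w i - w j) 0.
  by apply: le_trans d0 _; rewrite addr_ge0 // !mulr_ge0 // ltW.
have ij : i != j by apply: contraTneq d0 => ->; rewrite subrr ltxx.
pose d := w i - w j.
pose wh : 'rV[R]_m := \row_k ((w k - w j) / d).
have := hM (i, j) ij (rep 0 x, wh).
have K : osc_set i j (rep 0 x, wh).
  split; first exact: rep_near.
  move=> k; rewrite /osc_itv mxE /=; case: eqP => [->|_] /=.
    by rewrite divff // gt_eqF.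
  case: eqP => [->|_] /=; first by rewrite subrr mul0r.
  rewrite in_itv /= divr_ge0 ?subr_ge0 ?(ltW d0) ?hj //=.
  by rewrite ler_pdivrMr // mul1r; apply: lerB => //; exact: hi.
move=> /(_ K) /= h1.
have : pospart (rep 0 x, wh) <= m%:R * `|c| / d.
  apply: le_trans (_ : \sum_(k < m) `|c| / d <= _).
    apply: ler_sum => k _; rewrite ge_max divr_ge0 ?(ltW d0) //=.
    rewrite /rep hBper.
    have -> : \sum_l B x k l * wh ord0 l = (\sum_l B x k l * w l) / d.
      transitivity ((\sum_l (B x k l * w l - B x k l * w j)) / d).
        by rewrite mulr_suml; apply: eq_bigr => l _; rewrite mxE; ring.
      by rewrite big_split /= sumrN -mulr_suml B_sum0 mul0r subr0.
    rewrite ler_wpM2r ?invr_ge0 ?(ltW d0) //.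
    exact: le_trans (hw k) (ler_norm _).
  by rewrite sumr_const card_ord -mulrA -(mulr_natl (`|c| / d)).
move=> h2; have h3 : 1 <= M * (m%:R * `|c| / d).
  by apply: le_trans h1 _; rewrite ler_pM2l.
rewrite !mulrA ler_pdivlMr // mul1r in h3.
by rewrite -/d !mulrA; lra.
Qed.

(** Superdifferentials exist on a dense set and [H] is bounded below, so the
    coupling terms are bounded above everywhere.  This bounds the oscillation
    between components, hence also the coupling terms from below; coercivity
    then bounds superdifferentials, that is, increments. *)
Lemma subsolution_bounds a : exists C L : R, [/\ 0 < C, 0 < L & forall v, subsolution H B a v ->
  (forall x i j, v i x - v j x <= C) /\
  (forall i x z, v i x - v i z <= L * `|x - z|)].
Proof.
have [M M0 hM] := below_all.
have [C C0 hC] := osc_bound (a + M).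
have [b b0 hb] := B_bounded.
have [K K0 hK] := coercive_all (a + m%:R * (b * C)).
exists C, (N%:R * K + 1); split => //; first by rewrite ltr_wpDl // mulr_ge0 // ltW.
move=> v [cv hv].
have cpl x i : coupling_term B v x i <= a + M.
  rewrite leNgt; apply/negP => lt.
  have cc := @coupling_cont v i (fun j => proj1 (cv j)) x.
  have /cont_normP h := cc.
  have {h} [|r r0 hr] := h (coupling_term B v x i - (a + M)); first by rewrite subr_gt0.
  (* Otherwise [v_i] has no superdifferential near [x]. *)
  have : v i (x + 0) <= v i x + -1.
    apply: (superdiff_increment (rho := r)) => //; first exact: (proj1 (cv i)).
    move=> t z q _; rewrite scaler0 addr0 => /hr; rewrite ltr_norml => /andP [h1 _].
    by move=> /hv; have := hM i z q; lra.
  by rewrite addr0; lra.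
have osc x i j : v i x - v j x <= C by apply: (hC x (fun k => v k x)) => k; exact: cpl.
split => // i x z.
have cplge y : - (m%:R * (b * C)) <= coupling_term B v y i.
  rewrite coupling_rel lerNl -sumrN.
  apply: le_trans (_ : \sum_(j < m) b * C <= _); last first.
    by rewrite sumr_const card_ord mulr_natl.
  apply: ler_sum => j _; apply: le_trans (ler_norm _) _.
  rewrite normrN normrM; apply: ler_pM => //.
  by rewrite ler_norml; have := osc y i j; have := osc y j i; lra.
have : v i (z + (x - z)) <= v i z + (N%:R * K + 1) * `|x - z|.
  apply: (superdiff_increment (rho := 1)) => //; first exact: (proj1 (cv i)).
  move=> t y q _ _ /hv h.
  have /hK qK : H i y q <= a + m%:R * (b * C) by have := cplge y; lra.
  apply: le_trans (ler_norm _) _; apply: le_trans (dot_le_norm _ _) _.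
  rewrite mulrA mulrDl mul1r ler_wpDr // ler_wpM2r //.
  by rewrite ler_wpM2l.
by rewrite addrC subrK; lra.
Qed.

End System.

(** * Envelopes of subsolutions and the functions Phi *)

Section Envelopes.
Variables (R : realType) (N m : nat).
Variables (H : 'I_m -> 'rV[R]_N -> 'rV[R]_N -> R) (B : 'rV[R]_N -> 'M[R]_m).
Hypothesis hH : forall i, convex_hamiltonian (H i).
Hypothesis hBcont : forall i j, continuous (fun x => B x i j).
Hypothesis hBper : torus_fun B.
Hypothesis hBdeg : forall x, degenerate_coupling_matrix (B x).
Hypothesis hBirr : forall x, irreducible_matrix (B x).
Implicit Types (u v w : 'I_m -> 'rV[R]_N -> R) (x y z p q e : 'rV[R]_N).
Implicit Types (a c r s t eta eps : R) (i j k : 'I_m).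

Let bounds' := subsolution_bounds hH hBcont hBper hBdeg hBirr.
Let bounded' := B_bounded hBcont hBper.
Let coupling_rel' := coupling_rel hBdeg.

(** The modulus of continuity depends only on the bounds common to all
    subsolutions of level [a]. *)
Lemma coupling_unif a eta : 0 < eta -> exists2 r : R, 0 < r &
  forall v, subsolution H B a v -> forall x z i, `|z - x| < r ->
    `|coupling_term B v z i - coupling_term B v x i| < eta.
Proof.
move=> e0; have [C [L [C0 L0 hCL]]] := bounds' a.
have [b b0 hb] := bounded'.
pose M := m%:R * (C + b * (L + L)) + 1.
have M0 : 0 < M by rewrite ltr_wpDl // mulr_ge0 // addr_ge0 ?mulr_ge0 ?addr_ge0 // ltW.
pose d := eta / M; have d0 : 0 < d by rewrite divr_gt0.
have [r1 r10 hr1] : exists2 r : R, 0 < r & forall ij : 'I_m * 'I_m,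
   (fun ij r => forall x z, `|z - x| < r -> `|B z ij.1 ij.2 - B x ij.1 ij.2| < d) ij r.
  apply: fin_radius => [ij r r' rr h x z zx|[i j]].
    by apply: h; exact: lt_le_trans zx rr.
  apply: (@periodic_unif_cont R N (fun x => B x i j)) => //.
  by move=> x k; rewrite hBper.
exists (Num.min r1 d); first by rewrite lt_min r10.
move=> v /hCL [osc lip] x z i; rewrite lt_min => /andP [zr zd].
rewrite !coupling_rel' -sumrB.
apply: le_lt_trans (ler_norm_sum _ _ _) _.
apply: (@le_lt_trans _ _ (\sum_(j < m) d * (C + b * (L + L)))); last first.
  rewrite sumr_const card_ord -mulr_natl mulrCA.
  have : d * M = eta by rewrite /d divfK // gt_eqF.
  by rewrite /M mulrDr mulr1; lra.
apply: ler_sum => j _.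
have -> : B z i j * (v j z - v i z) - B x i j * (v j x - v i x) =
  (B z i j - B x i j) * (v j z - v i z) +
  B x i j * ((v j z - v j x) - (v i z - v i x)) by ring.
apply: le_trans (ler_normD _ _) _; rewrite [leRHS]mulrDr; apply: lerD.
  rewrite normrM; apply: ler_pM => //; first by rewrite ltW //; exact: (hr1 (i, j)).
  by rewrite ler_norml; have := osc z i j; have := osc z j i; lra.
rewrite normrM mulrCA; apply: ler_pM => //.
have lipn k : `|v k z - v k x| <= L * d.
  have : L * `|z - x| <= L * d by rewrite ler_pM2l // ltW.
  have := lip k z x; have := lip k x z; rewrite (distrC x z) ler_norml; lra.
apply: le_trans (ler_normB _ _) _; have := lipn i; have := lipn j; lra.
Qed.

(** Stability under suprema and limits at once: [u] need only be approximated,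
    for each component and each pair of points [x0], [z], by a subsolution that
    is almost as large at [x0], not much larger at [z], and whose other
    components are not much larger at [x0].  If a superdifferential [p] of
    [u_i] at [x0] violated the equation, a half-space separating [p] would
    bound the increments of all these approximations near [x0], on a
    neighbourhood common to all of them, hence those of [u_i]. *)
Lemma envelope_subsolution u : (forall i, torus_fun (u i)) ->
  (forall i x0 z eps, 0 < eps -> exists v, [/\ subsolution H B eps v,
     u i x0 - eps <= v i x0, v i z <= u i z + eps &
     forall j, j != i -> v j x0 <= u j x0 + eps]) ->
  subsolution H B 0 u.
Proof.
move=> pu env.
have [C [L [C0 L0 hCL]]] := bounds' 1.
have [b b0 hb] := bounded'.
have lip i x z : u i x - u i z <= L * `|x - z|.
  apply/ler_addgt0Pr => eps e0.
  pose d := Num.min 1 (eps / 2).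
  have d0 : 0 < d by rewrite lt_min ltr01 divr_gt0.
  have d1 : d <= 1 by rewrite ge_min lexx.
  have d2 : d <= eps / 2 by rewrite ge_min lexx orbT.
  have [v [/(subsolution_level d1)/hCL [_ vl] h1 h2 _]] := env i x z d d0.
  by have := vl i x z; lra.
have cu i : continuous (u i).
  move=> x; apply/cont_normP => eps e0; exists (eps / L); first by rewrite divr_gt0.
  move=> z; rewrite ltr_pdivlMr // => zx.
  by have := lip i z x; have := lip i x z; rewrite (distrC x z) ltr_norml; lra.
split => // x0 i p sp; rewrite leNgt; apply/negP => lt.
pose eta := (H i x0 p + coupling_term B u x0 i) / 4.
have e0 : 0 < eta by rewrite divr_gt0.
have [e [s [r [se r0 hr]]]] : exists e s r, [/\ s < dot p e, 0 < r &
    forall x' q, `|x' - x0| < r -> H i x' q <= - coupling_term B u x0 i + 3 * eta ->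
      dot q e <= s].
  by apply: (ham_support (hH i)) (lexx _); rewrite /eta; lra.
have [r1 r10 hr1] := coupling_unif 1 e0.
pose r2 := Num.min r r1 / 2.
have r20 : 0 < r2 by rewrite divr_gt0 // lt_min r0.
have r2E : r2 * 2 = Num.min r r1 by rewrite divfK.
have [t1 t10 ht1] := small_step e r20.
suff : dot p e <= s by lra.
apply: (superdiff_slope_le t10 sp) => t tt.
have t0 : 0 < t by case/andP: tt.
apply/ler_addgt0Pr => eps eps0.
pose d := Num.min (Num.min 1 (eps / 2)) (eta / (m%:R * b + b + 1)).
have mb : 0 < m%:R * b + b + 1 by rewrite ltr_wpDl // addr_ge0 ?mulr_ge0 // ltW.
have d0 : 0 < d by rewrite !lt_min ltr01 !divr_gt0.
have d1 : d <= 1 by rewrite !ge_min lexx.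
have d2 : d <= eps / 2 by rewrite !ge_min lexx orbT.
have d3 : d * (m%:R * b + b + 1) <= eta by rewrite -ler_pdivlMr // ge_min lexx orbT.
have [v [vs h1 h2 h3]] := env i x0 (x0 - t *: e) d d0.
have vs1 := subsolution_level d1 vs.
have cpl : coupling_term B u x0 i - eta <= coupling_term B v x0 i - d.
  have := @coupling_le _ _ _ _ hBdeg v (fun j z => u j z + d) x0 i h3.
  rewrite coupling_cst //.
  have : B x0 i i * (u i x0 + d - v i x0) <= b * (d + d).
    have := B_diag hBdeg x0 i; have := hb x0 i i => hb1 hb2.
    have : B x0 i i * (u i x0 + d - v i x0) <= B x0 i i * (d + d).
      by rewrite ler_wpM2l //; lra.
    move=> /le_trans; apply; rewrite ler_wpM2r //; last exact: le_trans (ler_norm _) hb1.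
    lra.
  have : b * d <= m%:R * b * d.
    rewrite -mulrA ler_peMl ?mulr_ge0 ?(ltW b0) ?(ltW d0) //.
    by rewrite ler1n; exact: leq_ltn_trans (leq0n _) (ltn_ord i).
  lra.
have : v i (x0 - t *: e + t *: e) <= v i (x0 - t *: e) + s * t.
  have [cv hv] := vs.
  apply: (superdiff_increment (rho := r2)) => //; first exact: (proj1 (cv i)).
  move=> t' x q t'01 xr sq.
  have : `|x - x0| < Num.min r r1.
    rewrite -r2E.
    have -> : x - x0 = (x - (x0 - t *: e + t' *: (t *: e))) + (t' - 1) *: (t *: e).
      by rewrite scalerBl scale1r opprD addrA opprB; apply/rowP => k; rewrite !mxE; ring.
    have : `|(t' - 1) *: (t *: e)| <= `|t *: e|.
      rewrite normrZ ler_piMl // ler_norml; lra.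
    have := ht1 _ tt.
    have := ler_normD (x - (x0 - t *: e + t' *: (t *: e))) ((t' - 1) *: (t *: e)).
    lra.
  rewrite lt_min => /andP [x1 x2].
  rewrite dotZr mulrC ler_pM2r //; apply: hr x1 _.
  have := hv _ _ _ sq; have := hr1 v vs1 x0 x i x2; rewrite ltr_norml => /andP [h4 _].
  lra.
rewrite subrK; lra.
Qed.

Definition limsup_seq (f : nat -> R) : R :=
  inf [set c | exists n0, forall n, (n0 <= n)%N -> f n <= c].

Lemma limsup_seqP (f : nat -> R) D : (forall n, `|f n| <= D) ->
  (forall eps, 0 < eps ->
    exists n0, forall n, (n0 <= n)%N -> f n <= limsup_seq f + eps) /\
  (forall eps n0, 0 < eps -> exists2 n, (n0 <= n)%N & limsup_seq f - eps <= f n).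
Proof.
move=> fD; rewrite /limsup_seq.
set S := [set c | _].
have S0 : S !=set0.
  by exists D, 0 => n _; apply: le_trans (ler_norm _) (fD n).
have lbS : has_lbound S.
  exists (- D) => c [n0 /(_ n0 (leqnn _))]; have := fD n0.
  by rewrite ler_norml; lra.
split.
  move=> eps e0; have [c [n0 hn] hc] := inf_adherent e0 (conj S0 lbS).
  by exists n0 => n /hn; lra.
move=> eps n0 e0; apply: contrapT => h.
have : S (inf S - eps).
  exists n0 => n nn; rewrite leNgt; apply/negP => lt.
  by apply: h; exists n => //; exact: ltW.
by move=> /(ge_inf lbS); lra.
Qed.

Hypothesis hc : critical_value H B = 0%E.

Lemma subsolution_above eps : 0 < eps -> exists u, subsolution H B eps u.
Proof.
move=> e0.
have [_ [a [u hu] <-] ha] : exists2 z, [set a%:E | a in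
    [set a : R | exists u, subsolution H B a u]] z & (z < eps%:E)%E.
  apply/ereal_inf_lt; rewrite -/(critical_value H B) hc lte_fin //.
by exists u; apply: subsolution_level hu; rewrite lte_fin in ha; exact: ltW.
Qed.

(** The upper limit of normalised subsolutions at levels decreasing to [0]. *)
Lemma critical_subsolution_exists (i0 : 'I_m) : exists u, subsolution H B 0 u.
Proof.
have [C [L [C0 L0 hCL]]] := bounds' 1.
have /choice [v0 hv0] : forall n : nat, exists v, subsolution H B n.+1%:R^-1 v.
  by move=> n; apply: subsolution_above; rewrite invr_gt0 ltr0n.
pose v n := fun j z => v0 n j z - v0 n i0 0.
have hv n : subsolution H B n.+1%:R^-1 (v n) by exact: subsolution_cst.
have hv1 n : subsolution H B 1 (v n).
  by apply: subsolution_level (hv n); rewrite invf_le1 ?ler1n ?ltr0n.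
have vb i x n : `|v n i x| <= C + L * `|x|.
  have [osc lip] := hCL _ (hv1 n).
  have e0 : v n i0 0 = 0 by rewrite /v subrr.
  have := osc x i i0; have := osc x i0 i; have := lip i0 x 0; have := lip i0 0 x.
  by rewrite e0 !subr0 !sub0r normrN ler_norml; lra.
pose u i x := limsup_seq (fun n => v n i x).
exists u; apply: envelope_subsolution.
  move=> i x k; rewrite /u; congr limsup_seq; apply/funext => n.
  by have [/(_ i) [_ ->]] := hv n.
move=> i x0 z eps eps0.
have /choice [f hf] : forall j, exists n0, forall n, (n0 <= n)%N -> v n j x0 <= u j x0 + eps.
  by move=> j; have [h _] := limsup_seqP (vb j x0); exact: h.
have [n1 hn1] := (limsup_seqP (vb i z)).1 eps eps0.
have [n] := (limsup_seqP (vb i x0)).2 eps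
  (maxn (\max_j f j) (maxn n1 (Num.bound eps^-1))) eps0.
rewrite !geq_max => /and3P [na nb nc] hn.
exists (v n); split => //.
- apply: subsolution_level (hv n).
  rewrite -[leRHS]invrK lef_pV2 ?posrE ?invr_gt0 //.
  apply: le_trans (_ : (Num.bound eps^-1)%:R <= _).
    by apply/ltW/archi_boundP; rewrite invr_ge0 ltW.
  by rewrite ler_nat (leq_trans nc).
- exact: hn1.
- move=> j _; apply: hf; apply: leq_trans na.
  exact: (leq_bigmax j).
Qed.

Lemma Phi_has_sup i j y x : has_sup [set v i x - v j y | v in [set v | subsolution H B 0 v]].
Proof.
have [C [L [C0 L0 hCL]]] := bounds' 0.
split.
  have [u hu] := critical_subsolution_exists i.
  by exists (u i x - u j y), u.
exists (C + L * `|x - y|) => _ [v /= hv <-].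
have [osc lip] := hCL _ hv.
by have := osc y i j; have := lip i x y; lra.
Qed.

Lemma Phi_ub v i j y x : subsolution H B 0 v -> v i x - v j y <= Phi H B i j y x.
Proof. by move=> hv; apply: (sup_upper_bound (Phi_has_sup i j y x)); exists v. Qed.

Lemma Phi_adherent i j y x eps : 0 < eps ->
  exists2 v, subsolution H B 0 v & Phi H B i j y x - eps < v i x - v j y.
Proof.
by move=> e0; have [_ [v hv <-] h] := sup_adherent e0 (Phi_has_sup i j y x); exists v.
Qed.

(** The supremum at the base point is over the single value [0]; it matters that
    critical subsolutions exist. *)
Lemma Phi_diag i y : Phi H B i i y y = 0.
Proof.
apply/eqP; rewrite eq_le; apply/andP; split.
  apply/ler_addgt0Pr => eps /(Phi_adherent i i y y) [v _].
  by rewrite subrr; lra.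
have [u hu] := critical_subsolution_exists i.
by have := Phi_ub i i y y hu; rewrite subrr.
Qed.

Lemma Phi_subsolution i0 y : subsolution H B 0 (fun k => Phi H B k i0 y).
Proof.
apply: envelope_subsolution.
  move=> i x k; rewrite /Phi; congr sup; apply/seteqP.
  by split => _ [v hv <-]; exists v => //=; case: hv => /(_ i) [_ ->].
move=> i x0 z eps e0.
have [v hv h] := Phi_adherent i i0 y x0 e0.
exists (fun j x => v j x + - v i0 y); split => //.
- by apply: subsolution_cst => //; apply: subsolution_level hv; exact: ltW.
- exact: ltW.
- by have := Phi_ub i i0 y z hv; lra.
- by move=> j _; have := Phi_ub j i0 y x0 hv; lra.
Qed.

End Envelopes.

(** * Gluing a test function into a subsolution *)

Section Glue.
Variables (R : realType) (N : nat).
Implicit Types (u f : 'rV[R]_N -> R) (x y z p : 'rV[R]_N) (r : R).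

(** Defined through representatives near [y], so that it is periodic although
    [f] need not be. *)
Definition glue u f y r x : R :=
  let x' := rep y x in if `|x' - y| < r then Num.max (u x') (f x') else u x'.

Lemma glue_per u f y r : torus_fun (glue u f y r).
Proof. by move=> x k; rewrite /glue rep_shift. Qed.

Lemma glue_in u f y r x : r < 2^-1 -> `|x - y| < r ->
  glue u f y r x = Num.max (u x) (f x).
Proof. by move=> r2 xr; rewrite /glue rep_id ?xr // (lt_trans xr). Qed.

Lemma glue_ge u f y r x : torus_fun u -> u x <= glue u f y r x.
Proof.
move=> pu; rewrite /glue -(rep_fun y x pu); case: ifP => // _.
by rewrite le_max lexx.
Qed.

Lemma glue_out u f y r r' x : torus_fun u ->
  (forall z, `|z - y| < r -> r' <= `|z - y| -> f z <= u z) ->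
  (forall k : 'rV[int]_N, r' <= `|x + map_mx intr k - y|) -> glue u f y r x = u x.
Proof.
move=> pu fu xr; rewrite /glue -[RHS](rep_fun y x pu); case: ifP => // h.
by apply/max_idPl/fu => //; exact: xr.
Qed.

Lemma rep_rep y x : rep y (rep y x) = rep y x.
Proof. by rewrite {2}/rep rep_shift. Qed.

(** Near a representative outside the ball of radius [r], any point with
    another representative inside the smaller ball would be a second
    representative of the same class, which the uniqueness of [rep] excludes
    since [r < 1/2]. *)
Lemma glue_near_out u f y r r' x0 : torus_fun u -> r < 2^-1 -> r' < r ->
  (forall z, `|z - y| < r -> r' <= `|z - y| -> f z <= u z) ->
  r <= `|rep y x0 - y| ->
  forall x, `|x - rep y x0| < r - r' -> glue u f y r x = u x.
Proof.
move=> pu r2 rr fu x0r x xx; apply: (glue_out pu fu) => k.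
rewrite leNgt; apply/negP => xk.
set a := rep y x0 in x0r xx *.
have h : `|a + map_mx intr k - y| < r.
  have := ler_normD (x + map_mx intr k - y) (a - x).
  have -> : x + map_mx intr k - y + (a - x) = a + map_mx intr k - y.
    by apply/rowP => i; rewrite !mxE; ring.
  by rewrite (distrC a x); lra.
have := rep_id (lt_trans h r2); rewrite rep_shift rep_rep -/a => e.
by rewrite -e in h; lra.
Qed.

Lemma max_cont u f x : {for x, continuous u} -> {for x, continuous f} ->
  {for x, continuous (fun z => Num.max (u z) (f z))}.
Proof.
move=> /cont_normP cu /cont_normP cf; apply/cont_normP => eps e0.
have [r r0 hr] := cu _ e0; have [s s0 hs] := cf _ e0.
exists (Num.min r s); first by rewrite lt_min r0.
move=> z; rewrite lt_min => /andP [/hr + /hs].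
rewrite !ltr_norml => /andP [a1 a2] /andP [b1 b2].
by case: (leP (u z) (f z)); case: (leP (u x) (f x)); lra.
Qed.

Lemma glue_cont u f y r r' : continuous u -> torus_fun u -> r < 2^-1 -> r' < r ->
  (forall z, `|z - y| < r -> {for z, continuous f}) ->
  (forall z, `|z - y| < r -> r' <= `|z - y| -> f z <= u z) ->
  continuous (glue u f y r).
Proof.
move=> cu pu r2 rr cf fu x0.
have h : {for rep y x0, continuous (glue u f y r)}.
  have [xr|xr] := ltP `|rep y x0 - y| r.
    have /cont_normP cm := max_cont (cu (rep y x0)) (cf _ xr).
    apply/cont_normP => eps /cm [s s0 hs].
    exists (Num.min s (r - `|rep y x0 - y|)); first by rewrite lt_min s0 subr_gt0.
    move=> z; rewrite lt_min => /andP [/hs + zr].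
    rewrite !glue_in //.
    by have := ler_distD (rep y x0) z y; lra.
  have /cont_normP cm := cu (rep y x0).
  apply/cont_normP => eps /cm [s s0 hs].
  exists (Num.min s (r - r')); first by rewrite lt_min s0 subr_gt0.
  move=> z; rewrite lt_min => /andP [/hs + zr].
  by rewrite !(glue_near_out (x0 := x0) pu r2 rr fu) // subrr normr0 subr_gt0.
apply/cont_normP => eps e0; have /cont_normP /(_ _ e0) [s s0 hs] := h.
exists s => // z zx; have := hs (z + map_mx intr (near_rep y x0)).
rewrite glue_per [glue u f y r (rep y x0)]glue_per; apply.
by rewrite /rep opprD addrACA subrr addr0.
Qed.

Lemma max_near_right u f y : {for y, continuous u} -> {for y, continuous f} ->
  u y < f y -> exists2 s : R, 0 < s & forall z, `|z - y| < s -> u z < f z.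
Proof.
move=> /cont_normP cu /cont_normP cf lt.
have e0 : 0 < (f y - u y) / 2 by rewrite divr_gt0 // subr_gt0.
have [r r0 hr] := cu _ e0; have [s s0 hs] := cf _ e0.
exists (Num.min r s); first by rewrite lt_min r0.
by move=> z; rewrite lt_min => /andP [/hr + /hs]; rewrite !ltr_norml; lra.
Qed.

Lemma C1_near_addc f c x : C1_near f x -> C1_near (fun z => f z + c) x.
Proof.
move=> /C1_nearE [r r0 h].
apply: (C1_nearI (G := fun z => gradient f z) r0) => z /h [ef cf]; last exact: cf.
by rewrite -[gradient f z]addr0; apply: expandsD => //; exact: expands_cst.
Qed.

End Glue.

Section Raise.
Variables (R : realType) (N m : nat).
Variables (H : 'I_m -> 'rV[R]_N -> 'rV[R]_N -> R) (B : 'rV[R]_N -> 'M[R]_m).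
Hypothesis hH : forall i, convex_hamiltonian (H i).
Hypothesis hBcont : forall i j, continuous (fun x => B x i j).
Hypothesis hBper : torus_fun B.
Hypothesis hBdeg : forall x, degenerate_coupling_matrix (B x).
Hypothesis hBirr : forall x, irreducible_matrix (B x).
Implicit Types (u v w : 'I_m -> 'rV[R]_N -> R) (x y z p q e : 'rV[R]_N).
Implicit Types (a c r s t eta eps : R) (i j k : 'I_m).

Definition raises v i w := [/\ subsolution H B 0 w, forall j x, v j x <= w j x &
  forall j, j != i -> w j = v j].

(** Strictness at a point where the component is [C^1]; by continuity the
    inequality then holds in a neighbourhood. *)
Definition smooth_strict w i y :=
  C1_near (w i) y /\ H i y (gradient (w i) y) + coupling_term B w y i < 0.

Lemma coupling_raise v i w x : (forall j, j != i -> w j = v j) ->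
  coupling_term B w x i = coupling_term B v x i + B x i i * (w i x - v i x).
Proof.
move=> wv; rewrite /coupling_term (bigD1 i) //= [in RHS](bigD1 i) //=.
have -> : \sum_(j < m | j != i) B x i j * w j x = \sum_(j < m | j != i) B x i j * v j x.
  by apply: eq_bigr => j /wv ->.
by ring.
Qed.

Lemma coupling_raise_other v i w x j : i != j -> (forall k, k != i -> w k = v k) ->
  coupling_term B w x j = coupling_term B v x j + B x j i * (w i x - v i x).
Proof.
move=> ij wv; rewrite /coupling_term (bigD1 i) //= [in RHS](bigD1 i) //=.
have -> : \sum_(k < m | k != i) B x j k * w k x = \sum_(k < m | k != i) B x j k * v k x.
  by apply: eq_bigr => k /wv ->.
by ring.
Qed.

(** At each point the superdifferential of the maximum is contained in that of
    the larger function.  Where [f] wins, its coupling term exceeds that of [v]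
    by the diagonal coefficient times [f - v_i]; elsewhere nothing changes in
    the [i]-th equation, and the other equations only improve. *)
Lemma glue_subsolution v i (f : 'rV[R]_N -> R) y r r' : subsolution H B 0 v ->
  r < 2^-1 -> r' < r ->
  (forall z, `|z - y| < r -> {for z, continuous f}) ->
  (forall z, `|z - y| < r -> r' <= `|z - y| -> f z <= v i z) ->
  (forall x p, `|x - y| < r -> v i x <= f x -> superdiff f x p ->
     H i x p + coupling_term B v x i + B x i i * (f x - v i x) <= 0) ->
  exists w, [/\ raises v i w,
    forall x, `|x - y| < r -> w i x = Num.max (v i x) (f x) &
    forall x, (forall k : 'rV[int]_N, r' <= `|x + map_mx intr k - y|) -> w i x = v i x].
Proof.
move=> [cv hv] r2 rr cf fv hf.
have [ci pi] := cv i.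
pose w j := if j == i then glue (v i) f y r else v j.
have wi : w i = glue (v i) f y r by rewrite /w eqxx.
have wj j : j != i -> w j = v j by rewrite /w => /negPf ->.
have wge j x : v j x <= w j x.
  by rewrite /w; case: eqP => // ->; exact: glue_ge.
have cw : continuous_on_torus w.
  move=> j; have [->|ji] := eqVneq j i; last by rewrite wj.
  by rewrite wi; split; [exact: glue_cont rr cf fv|exact: glue_per].
exists w; split; last 2 first.
- by move=> x xr; rewrite wi glue_in.
- by move=> x xr; rewrite wi (glue_out pi fv xr).
split => //; split => // x j p.
have [->{j}|ji] := eqVneq j i; last first.
  rewrite wj // => /hv; have ij : i != j by rewrite eq_sym.
  rewrite (coupling_raise_other _ ij wj).
  have : B x j i * (w i x - v i x) <= 0.
    by rewrite mulr_le0_ge0 ?subr_ge0 //; exact: B_off.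
  by lra.
move=> /(superdiff_periodic (near_rep y x) (proj2 (cw i))).
rewrite -/(rep y x) => sp.
have pw : forall j, torus_fun (w j) by move=> j; case: (cw j).
have -> : coupling_term B w x i = coupling_term B w (rep y x) i.
  by rewrite /rep coupling_per.
rewrite -(rep_fun y x (ham_per (hH i) p)).
move: (rep y x) sp (@glue_near_out _ _ (v i) f y r r' x pi r2 rr fv) => a sp hout.
rewrite (coupling_raise a wj).
have [ar|ar] := ltP `|a - y| r; last first.
  have ra : 0 < r - r' by rewrite subr_gt0.
  have e : w i a = v i a by rewrite wi hout // subrr normr0.
  rewrite e subrr mulr0 addr0; apply: hv.
  apply: (superdiff_le ra _ _ sp) => [z zr|]; last by rewrite e.
  by rewrite wi hout.
have ra : 0 < r - `|a - y| by rewrite subr_gt0.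
have win z : `|z - a| < r - `|a - y| -> w i z = Num.max (v i z) (f z).
  by move=> za; rewrite wi glue_in //; have := ler_distD a z y; lra.
have wa : w i a = Num.max (v i a) (f a) by apply: win; rewrite subrr normr0.
have [vf|fv'] := leP (v i a) (f a).
  rewrite wa (max_idPr vf).
  have : superdiff f a p.
    apply: (superdiff_le ra _ _ sp) => [z zr|]; last by rewrite wa (max_idPr vf).
    by rewrite win // le_max lexx orbT.
  by move=> /(hf _ _ ar vf); lra.
rewrite wa (max_idPl (ltW fv')) subrr mulr0 addr0; apply: hv.
apply: (superdiff_le ra _ _ sp) => [z zr|]; last by rewrite wa (max_idPl (ltW fv')).
by rewrite win // le_max lexx.
Qed.

(** Glue in [f = g + const - |x - y|^2], where [g] touches [v_i] from below at
    [y] with gradient [p] and the constant puts [f] slightly above [v_i] at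
    [y].  The quadratic term makes [f] fall below [v_i] before leaving a small
    ball, on which [f] is still strict by continuity. *)
Lemma smooth_raise v i y p r0 : subsolution H B 0 v -> subdiff (v i) y p ->
  H i y p + coupling_term B v y i < 0 -> 0 < r0 ->
  exists w, [/\ raises v i w, smooth_strict w i y, v i y < w i y &
    forall x, (forall k : 'rV[int]_N, r0 <= `|x + map_mx intr k - y|) -> w i x = v i x].
Proof.
move=> sv /subdiff_touch [g [C1g eg [r1 r10 hg]]] neg r00.
have [cv hv] := sv.
(* A third of the margin for the variation of [H], one for that of the
   coupling term, and one for the diagonal term of the raised component. *)
pose eta := - (H i y p + coupling_term B v y i) / 3.
have e0 : 0 < eta by rewrite divr_gt0 // oppr_gt0.
pose f0 x := g x + (- 1) * dot (x - y) (x - y).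
have C1f0 : C1_near f0 y by exact: C1_near_add_sqr.
have ef0 : expands f0 y p.
  rewrite -[p]addr0 -[X in p + X](scaler0 _ (2 * (- 1))) -[X in _ *: X](subrr y).
  by apply: expandsD => //; exact: expands_sqr.
have [r2 r20 hr2] := C1_nearE C1f0.
have gp : gradient f0 y = p by case: (expands_diff ef0).
have [r3 r30 hr3] := ham_unif (hH i) `|p| e0.
have [_ cg] := hr2 y ltac:(by rewrite subrr normr0).
have /cont_normP /(_ _ r30) [r4 r40 hr4] := cg.
have /cont_normP /(_ _ e0) [r5 r50 hr5] :=
  @coupling_cont _ _ _ _ hBcont v i (fun j => proj1 (cv j)) y.
have [b b0 hb] := B_bounded hBcont hBper.
pose r := Num.min (Num.min (Num.min r0 r1) (Num.min r2 r3))
             (Num.min (Num.min r4 r5) (4^-1)).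
have r_gt0 : 0 < r by rewrite !lt_min r00 r10 r20 r30 r40 r50 invr_gt0 ltr0n.
have rlt x : `|x - y| < r -> [/\ `|x - y| < r1, `|x - y| < r2, `|x - y| < r3,
   `|x - y| < r4 & `|x - y| < r5].
  by rewrite !lt_min => /andP [/andP [/andP [_ ->] /andP [-> ->]] /andP [/andP [-> ->] _]].
have rle0 : r <= r0 by rewrite !ge_min lexx.
have r4' : r <= 4^-1 by rewrite !ge_min lexx !orbT.
have r12 : r < 2^-1 by apply: le_lt_trans r4' _; rewrite ltf_pV2 ?posrE // ltr_nat.
clearbody r.
pose r' := r / 2.
have r'0 : 0 < r' by rewrite divr_gt0.
have rr' : r' < r by rewrite /r'; lra.
(* [eps] is the height of the bump: below [r'^2] so that [f] is under [v_i]
   beyond distance [r'], and below [eta / b] for the diagonal term. *)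
pose eps := Num.min (eta / b) (r' ^+ 2).
have eps0 : 0 < eps by rewrite lt_min divr_gt0 // exprn_gt0.
have beps : b * eps <= eta by rewrite mulrC -ler_pdivlMr // ge_min lexx.
have repsq : eps <= r' ^+ 2 by rewrite ge_min lexx orbT.
clearbody eps.
pose f x := f0 x + (v i y - g y + eps).
have fE x : f x = g x - dot (x - y) (x - y) + (v i y - g y + eps).
  by rewrite /f /f0 mulN1r.
have fy : f y = v i y + eps by rewrite fE subrr dot0l; ring.
have C1f : C1_near f y by exact: C1_near_addc.
have ef x : `|x - y| < r -> expands f x (gradient f0 x).
  move=> /rlt [_ /hr2 [h _] _ _ _]; rewrite -[gradient f0 x]addr0.
  by apply: expandsD => //; exact: expands_cst.
have feps x : `|x - y| < r -> f x - v i x <= eps - dot (x - y) (x - y).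
  by move=> /rlt [/hg h _ _ _ _]; rewrite fE; lra.
have Beps x t : t <= eps -> B x i i * t <= eta.
  move=> te; apply: le_trans (ler_wpM2l (B_diag hBdeg x i) te) _.
  apply: le_trans beps; rewrite ler_wpM2r ?(ltW eps0) //.
  exact: le_trans (ler_norm _) (hb x i i).
have [w [rw win wout]] : exists w, [/\ raises v i w,
    forall x, `|x - y| < r -> w i x = Num.max (v i x) (f x) &
    forall x, (forall k : 'rV[int]_N, r' <= `|x + map_mx intr k - y|) -> w i x = v i x].
  apply: glue_subsolution => //.
  - move=> z zr; apply: differentiable_continuous.
    by have [] := expands_diff (ef z zr).
  - move=> z zr zr'; have := feps z zr; have := norm_le_dot (z - y).
    have : r' ^+ 2 <= `|z - y| ^+ 2.
      by rewrite ler_pXn2r // ?nnegrE ?normr_ge0 ?(ltW r'0).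
    by lra.
  - move=> x q xr vf /superdiff_unique /(_ (ef x xr)) ->.
    have [x1 x2 x3 x4 x5] := rlt x xr.
    have := hr3 y x p (gradient f0 x) x3; rewrite lexx -gp => /(_ (hr4 _ x4) isT).
    have := hr5 _ x5; rewrite gp !ltr_norml => /andP [_ h1] /andP [_ h2].
    have : B x i i * (f x - v i x) <= eta.
      by apply: Beps; have := feps x xr; have := dot_ge0 (x - y); lra.
    by rewrite /eta in h1 h2 *; lra.
have yr : `|y - y| < r by rewrite subrr normr0.
have wy : w i y = v i y + eps.
  by rewrite win // fy; apply/max_idPr; rewrite lerDl ltW.
exists w; split; [exact: rw| |by rewrite wy ltrDl|]; last first.
  by move=> x xr; apply: wout => k; have := xr k; lra.
have [s s0 hs] : exists2 s : R, 0 < s & forall z, `|z - y| < s -> f z = w i z.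
  have cf : {for y, continuous f}.
    by apply: differentiable_continuous; have [] := expands_diff (ef y yr).
  have [|s1 s10 h1] := max_near_right ((proj1 (cv i)) y) cf; first by rewrite fy ltrDl.
  exists (Num.min r s1); first by rewrite !lt_min r_gt0 s10.
  move=> z; rewrite !lt_min => /andP [zr /h1 z1].
  by rewrite win //; apply/esym/max_idPr/ltW.
split; first exact: C1_near_local s0 hs C1f.
have efy : expands (w i) y p.
  by apply: (expands_local s0 hs); rewrite -gp; exact: ef.
have [_ ->] := expands_diff efy.
have [_ _ wj] := rw; rewrite (coupling_raise y wj) wy.
have := Beps y (v i y + eps - v i y); rewrite addrAC subrr add0r => /(_ (lexx _)).
by rewrite /eta in e0 *; lra.
Qed.

End Raise.

(** * Smoothing a strict component and propagating strictness *)

Section Propagation.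
Variables (R : realType) (N m : nat).
Variables (H : 'I_m -> 'rV[R]_N -> 'rV[R]_N -> R) (B : 'rV[R]_N -> 'M[R]_m).
Hypothesis hH : forall i, convex_hamiltonian (H i).
Hypothesis hBcont : forall i j, continuous (fun x => B x i j).
Hypothesis hBper : torus_fun B.
Hypothesis hBdeg : forall x, degenerate_coupling_matrix (B x).
Hypothesis hBirr : forall x, irreducible_matrix (B x).
Implicit Types (u v w : 'I_m -> 'rV[R]_N -> R) (x y z p q e : 'rV[R]_N).
Implicit Types (a c r s t eta eps : R) (i j k : 'I_m).

Definition visc_strict v i y := exists rho delta : R, [/\ 0 < rho, 0 < delta &
  forall x p, `|x - y| < rho -> superdiff (v i) x p ->
    H i x p + coupling_term B v x i <= - delta].

Lemma raises_trans u v w i : raises H B u i v -> raises H B v i w -> raises H B u i w.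
Proof.
move=> [_ uv vu] [sw vw wv]; split => // [j x|j ji].
  exact: le_trans (uv j x) (vw j x).
by rewrite wv // vu.
Qed.

(** First [v_j] is replaced near [y] by
    [f(x) = v_j(x + h) + 2 om - c |x - y|^2], where [v_j] has a
    subdifferential at [y + h].  For small [h] the translate differs from
    [v_j] by less than [om] and, by continuity of [H], keeps most of the strict
    margin; the quadratic term localises the change at a cost in gradient
    proportional to [om].  The new component has a subdifferential at [y], on
    which the equation is strictly negative by [subdiff_subsolution], so
    [smooth_raise] applies. *)
Lemma strict_smoothing v j y : subsolution H B 0 v -> visc_strict v j y ->
  exists2 w, raises H B v j w & smooth_strict H B w j y.
Proof.
move=> sv [r0 [delta [r00 d0 hd]]].
have [cv hv] := sv; have [cj pj] := cv j.
have [b b0 hb] := B_bounded hBcont hBper.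
pose eta := delta / 8; have e0 : 0 < eta by rewrite divr_gt0.
have ccv := @coupling_cont _ _ _ _ hBcont v j (fun k => proj1 (cv k)).
have /cont_normP /(_ _ e0) [r5 r50 hr5] := ccv y.
have [K K0 hK] := ham_coercive (hH j) (- delta - coupling_term B v y j + eta).
have [r3 r30 hr3] := ham_unif (hH j) K e0.
pose r := Num.min (Num.min r0 r5) 2^-1 / 2.
have r_gt0 : 0 < r by rewrite divr_gt0 // !lt_min r00 r50 invr_gt0 ltr0n.
have r2E : r * 2 = Num.min (Num.min r0 r5) 2^-1 by rewrite divfK.
have rlt t : t < r * 2 -> t < r0 /\ t < r5.
  by rewrite r2E !lt_min => /andP [/andP []].
have r12 : r < 2^-1.
  have : r * 2 <= 2^-1 by rewrite r2E ge_min lexx orbT.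
  by lra.
clearbody r.
pose r' := r / 2.
have r'0 : 0 < r' by rewrite divr_gt0.
have rr' : r' < r by rewrite /r'; lra.
(* [om] is small enough for the diagonal term to cost at most [2 eta] and for
   the quadratic term below to change gradients by less than [r3]. *)
pose om := Num.min (eta / b / 2) (r3 * r' ^+ 2 / (12 * r)).
have om0 : 0 < om.
  rewrite lt_min; apply/andP; split; first by rewrite !divr_gt0.
  by rewrite divr_gt0 ?mulr_gt0 // exprn_gt0.
have om1 : b * (3 * om) <= 2 * eta.
  have : om <= eta / b / 2 by rewrite ge_min lexx.
  rewrite ler_pdivlMr // ler_pdivlMr // => h.
  by lra.
have om2 : om * (12 * r) <= r3 * r' ^+ 2.
  by rewrite -ler_pdivlMr ?mulr_gt0 // ge_min lexx orbT.
clearbody om.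
(* The value of [c] for which [f <= v_j] at distance at least [r'] from [y]. *)
pose c := 3 * om / r' ^+ 2.
have c0 : 0 < c by rewrite divr_gt0 ?exprn_gt0 // mulr_gt0.
have cE : c * r' ^+ 2 = 3 * om by rewrite /c divfK // expf_neq0 // gt_eqF.
have cr : 2 * c * r < r3.
  have r'2 : 0 < r' ^+ 2 by rewrite exprn_gt0.
  rewrite -(ltr_pM2r r'2).
  have -> : 2 * c * r * r' ^+ 2 = 2 * r * (c * r' ^+ 2) by ring.
  rewrite cE.
  have : 0 < om * r by rewrite mulr_gt0.
  by lra.
clearbody c.
have [r6 r60 hr6] := periodic_unif_cont pj cj om0.
have [z [p0 [zy sp0]]] := @subdiff_dense R N (v j) y (Num.min r (Num.min r6 r3)) cj
  ltac:(by rewrite !lt_min r_gt0 r60).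
pose h := z - y.
have zE : z = y + h by rewrite /h addrC subrK.
move: zy; rewrite -/h !lt_min => /and3P [hr h6 h3].
have osc x : `|v j (x + h) - v j x| < om.
  by apply: hr6; rewrite addrAC subrr add0r.
pose u2 x := v j (x + h) + 2 * om.
pose f x := u2 x + (- c) * dot (x - y) (x - y).
have cf x : {for x, continuous f}.
  apply: continuous_at_add.
    apply: continuous_at_add; last exact: cst_continuous.
    apply/cont_normP => eps eps0.
    have /cont_normP /(_ _ eps0) [s s0 hs] := cj (x + h).
    by exists s => // z' zx; apply: hs; rewrite opprD addrACA subrr addr0.
  apply: differentiable_continuous.
  by have [] := expands_diff (expands_sqr (- c) y x).
have fv x : f x - v j x <= 3 * om - c * dot (x - y) (x - y).
  by have := osc x; rewrite ltr_norml /f /u2; lra.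
have fv3 x : f x - v j x <= 3 * om.
  have : 0 <= c * dot (x - y) (x - y) by rewrite mulr_ge0 ?dot_ge0 // ltW.
  by have := fv x; lra.
have key x p : `|x - y| < r -> superdiff f x p ->
    H j x p + coupling_term B v x j + B x j j * (f x - v j x) <= - (3 * eta).
  move=> xr /superdiff_add_sqr; set p1 := p - _ => /superdiff_addc /superdiff_shift sp1.
  have [x0 x5] : `|x - y| < r0 /\ `|x - y| < r5 by apply: rlt; lra.
  have [xh0 xh5] : `|x + h - y| < r0 /\ `|x + h - y| < r5.
    apply: rlt; rewrite addrAC; have := ler_normD (x - y) h; lra.
  have h1 := hd _ _ xh0 sp1.
  have := hr5 _ x5; have := hr5 _ xh5; rewrite !ltr_norml => /andP [a1 a2] /andP [b1 b2].
  have p1K : `|p1| <= K by apply: hK (x + h) _ _; lra.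
  have := hr3 (x + h) x p1 p.
  have -> : x - (x + h) = - h by rewrite opprD addrA subrr add0r.
  have -> : p - p1 = (- (2 * c)) *: (x - y).
    by rewrite /p1 opprB addrC subrK mulrN.
  rewrite normrN normrZ normrN (gtr0_norm (mulr_gt0 (ltr0n _ 2) c0)).
  have : 2 * c * `|x - y| <= 2 * c * r by rewrite ler_pM2l ?mulr_gt0 // ltW.
  move=> h2 /(_ h3 (le_lt_trans h2 cr) p1K); rewrite ltr_norml => /andP [_ h4].
  have : B x j j * (f x - v j x) <= 2 * eta.
    apply: le_trans (ler_wpM2l (B_diag hBdeg x j) (fv3 x)) _.
    apply: le_trans om1; apply: ler_wpM2r; first by rewrite mulr_ge0 // ltW.
    exact: le_trans (ler_norm _) (hb x j j).
  by rewrite /eta in e0 a1 a2 b1 b2 h4 *; lra.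
have [w [rw win _]] : exists w, [/\ raises H B v j w,
    forall x, `|x - y| < r -> w j x = Num.max (v j x) (f x) &
    forall x, (forall k : 'rV[int]_N, r' <= `|x + map_mx intr k - y|) -> w j x = v j x].
  apply: (glue_subsolution hH hBper hBdeg) => //.
  - move=> x xr xr'; have := fv x; have := norm_le_dot (x - y) => h1.
    have : r' ^+ 2 <= `|x - y| ^+ 2.
      by rewrite ler_pXn2r // ?nnegrE ?normr_ge0 ?(ltW r'0).
    move=> h2; have : c * r' ^+ 2 <= c * dot (x - y) (x - y).
      by rewrite ler_pM2l //; exact: le_trans h1.
    by rewrite cE; lra.
  - by move=> x p xr _ /(key x p xr); lra.
have fy : v j y < f y.
  rewrite /f /u2 subrr dot0l mulr0 addr0.
  by have := osc y; rewrite ltr_norml; lra.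
have [s1 s10 hs1] := max_near_right (cj y) (cf y) fy.
pose s := Num.min r s1; have s0 : 0 < s by rewrite lt_min r_gt0.
have wf x : `|x - y| < s -> w j x = f x.
  rewrite lt_min => /andP [xr /hs1 lt]; rewrite win //.
  exact/max_idPr/ltW.
have [sw vw wv] := rw; have [cw hw] := sw.
have sp : subdiff (w j) y p0.
  have : subdiff f y p0.
    have -> : p0 = p0 + (2 * (- c)) *: (y - y) by rewrite subrr scaler0 addr0.
    by apply: subdiff_add_sqr; apply: subdiff_addc; apply: subdiff_unshift; rewrite -zE.
  apply: (subdiff_le s0) => [x /wf ->//|].
  by rewrite wf // subrr normr0.
have neg : H j y p0 + coupling_term B w y j <= - (3 * eta).
  have : H j y p0 <= - (3 * eta) - coupling_term B w y j.
    apply: (subdiff_subsolution (hH j) (proj1 (cw j))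
      (g := fun x => - (3 * eta) - coupling_term B w x j) _ s0 _ sp).
      apply: continuous_at_add; first exact: cst_continuous.
      apply: continuousN.
      exact: (@coupling_cont _ _ _ _ hBcont w j (fun k => proj1 (cw k))).
    move=> x q xs sq.
    have sf : superdiff f x q.
      apply: (@superdiff_le _ _ (w j) f x q (s - `|x - y|)) => //; rewrite ?subr_gt0 ?wf //.
      by move=> a ax; rewrite wf //; have := ler_distD x a y; lra.
    have xr : `|x - y| < r by move: xs; rewrite lt_min => /andP [].
    have := key _ _ xr sf; rewrite (coupling_raise _ x wv) (wf _ xs); lra.
  by lra.
have [|w2 [rw2 ss _ _]] := smooth_raise hH hBcont hBper hBdeg sw sp _ (@ltr01 R).
  by lra.
by exists w2 => //; exact: raises_trans rw rw2.
Qed.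

Lemma smooth_strict_raise v j w k y : k != j -> raises H B v j w ->
  smooth_strict H B v k y -> smooth_strict H B w k y.
Proof.
move=> kj [_ vw wv] [C1 neg]; rewrite /smooth_strict wv //; split => //.
have jk : j != k by rewrite eq_sym.
rewrite (coupling_raise_other B y jk wv).
have : B y k j * (w j y - v j y) <= 0.
  by rewrite mulr_le0_ge0 ?subr_ge0 //; exact: B_off.
by lra.
Qed.

(** Once the [k]-th component is strict at [y] it can be raised there; this
    lowers the coupling term of the [j]-th equation by a positive amount when
    [b_jk(y)] is nonzero. *)
Lemma strict_propagates v k j y : subsolution H B 0 v -> smooth_strict H B v k y ->
  j != k -> B y j k != 0 ->
  exists w, [/\ raises H B v k w, smooth_strict H B w k y & visc_strict w j y].
Proof.
move=> sv [C1 neg] jk Bjk.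
have sp : subdiff (v k) y (gradient (v k) y).
  have [r r0 hr] := C1_nearE C1.
  by apply: subdiff_C1 => //; have [] := hr y; rewrite ?subrr ?normr0.
have [w [rw ss lt _]] := smooth_raise hH hBcont hBper hBdeg sv sp neg (@ltr01 R).
exists w; split => //.
have [sw vw wv] := rw; have [cv hv] := sv; have [cw hw] := sw.
have kj : k != j by rewrite eq_sym.
pose d := - (B y j k * (w k y - v k y)).
have d0 : 0 < d.
  rewrite oppr_gt0 nmulr_rlt0 ?subr_gt0 // lt_neqAle Bjk.
  exact: B_off.
have cc : {for y, continuous (fun x => B x j k * (w k x - v k x))}.
  apply: continuous_at_mul; first exact: hBcont.
  apply: continuous_at_add; first exact: (proj1 (cw k)).
  by apply: continuousN; exact: (proj1 (cv k)).
have d2 : 0 < d / 2 by rewrite divr_gt0.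
have /cont_normP /(_ _ d2) [r r0 hr] := cc.
exists r, (d / 2); split => // x p xr.
rewrite wv // => /hv; rewrite (coupling_raise_other _ x kj wv).
have := hr _ xr; rewrite ltr_norml -/d => /andP [_].
by rewrite /d in d0 *; lra.
Qed.

(** By irreducibility the set of smooth and strict components can be enlarged
    as long as it is not everything: some equation outside it is coupled to a
    component inside it. *)
Lemma all_smooth_strict v i y : subsolution H B 0 v -> visc_strict v i y ->
  exists2 w, subsolution H B 0 w & forall k, smooth_strict H B w k y.
Proof.
move=> sv vs; have [w0 [sw0 _ _] ss0] := strict_smoothing sv vs.
have : exists S : {set 'I_m}, S != finset.set0 /\
    forall k, k \in S -> smooth_strict H B w0 k y.
  exists [set i]%SET; split; first by apply/set0Pn; exists i; rewrite inE.
  by move=> k; rewrite inE => /eqP ->.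
clear ss0 => -[S [S0 hS]].
have [n] := ubnP #|(~: S)%SET|.
elim: n => // n IH in w0 sw0 S S0 hS *.
rewrite ltnS => Sn.
have [SC|/set0Pn [l lS]] := eqVneq (~: S)%SET finset.set0.
  exists w0 => // k; apply: hS.
  by have : k \notin (~: S)%SET; [rewrite SC inE|rewrite inE negbK].
have [||j [k [jS kS Bjk]]] := @hBirr y (~: S)%SET.
- by apply/set0Pn; exists l.
- have /set0Pn [q qS] := S0; apply/properP; split; first exact: finset.subsetT.
  by exists q => //; rewrite inE qS.
rewrite inE in jS; rewrite inE negbK in kS.
have jk : j != k by apply: contraNneq jS => ->.
have [w1 [rw1 ss1 vs1]] := strict_propagates sw0 (hS k kS) jk Bjk.
have [w2 rw2 ss2] := strict_smoothing (let: And3 h _ _ := rw1 in h) vs1.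
have sw2 : subsolution H B 0 w2 by case: rw2.
apply: (IH w2 sw2 (j |: S)%SET).
- by apply/set0Pn; exists j; rewrite !inE eqxx.
- move=> q; rewrite !inE; have [->//|qj] := eqVneq q j => /= qS.
  apply: (smooth_strict_raise qj rw2).
  have [->//|qk] := eqVneq q k.
  by apply: (smooth_strict_raise qk rw1); exact: hS.
- apply: leq_trans Sn; apply: proper_card; apply/properP; split.
    by apply/fintype.subsetP => q; rewrite !inE negb_or => /andP [].
  by exists j; rewrite !inE // eqxx.
Qed.

End Propagation.

(** * Null sets along lines *)

Section Slicing.
Variable R : realType.
Let mu := @lebesgue_measure R.
Implicit Types (E : set R) (a b x e eps : R).

(** The parameters [t] at which the point [x + z + t e] of the line lies in
    [[a, b]]: one coordinate of the intersection of a line with a box. *)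
Definition band a b x e (z : R) : set R := [set t | a <= x + z + t * e <= b].

Let band_set E a b x e : set (R * R) :=
  [set w | E w.2 /\ a <= x + w.1 + w.2 * e <= b].

Let measurable_band_set E a b x e : measurable E -> measurable (band_set E a b x e).
Proof.
move=> mE.
have -> : band_set E a b x e =
    ([set: R] `*` E) `&` ((fun w : R * R => x + w.1 + w.2 * e) @^-1` [set` `[a, b]]).
  by apply/seteqP; split => [w [Ew hw]|w [[_ Ew] hw]]; split => //=;
    rewrite in_itv in hw *.
apply: measurableI; first exact: measurableX.
rewrite -[X in measurable X]setTI.
have mf : measurable_fun setT (fun w : R * R => x + w.1 + w.2 * e).
  apply: measurable_funD.
    by apply: measurable_funD => //; exact: measurable_fst.
  by apply: measurable_funM => //; exact: measurable_snd.
by apply: mf => //; exact: measurable_itv.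
Qed.

Lemma measurable_band a b x e z : measurable (band a b x e z).
Proof.
have -> : band a b x e z = xsection (band_set setT a b x e) z.
  apply/seteqP; split => t; rewrite /xsection /= ?mem_setE.
    by move=> h; apply/mem_set; split.
  by move=> /set_mem [].
by apply: measurable_xsection; exact: measurable_band_set.
Qed.

Lemma band_section E a b x e z :
  xsection (band_set E a b x e) z = E `&` band a b x e z.
Proof.
apply/seteqP; split => t; rewrite /xsection /=; first by move=> /set_mem.
by move=> h; exact/mem_set.
Qed.

Lemma measurable_fun_band E a b x e : measurable E ->
  measurable_fun setT ((fun z => mu (E `&` band a b x e z)) : R -> \bar R).
Proof.
move=> mE; have := measurable_fun_xsection mu (measurable_band_set a b x e mE).
have -> // : mu \o xsection (band_set E a b x e) =
   ((fun z => mu (E `&` band a b x e z)) : R -> \bar R).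
by apply/funext => z /=; rewrite band_section.
Qed.

(** Tonelli: for fixed [t] the admissible translations [z] form an interval of
    length [b - a]. *)
Lemma integral_band E a b x e : measurable E -> a <= b ->
  (\int[mu]_z mu (E `&` band a b x e z) = (b - a)%:E * mu E)%E.
Proof.
move=> mE ab.
have mA := measurable_band_set a b x e mE.
have -> : ((fun z => mu (E `&` band a b x e z)) : R -> \bar R) =
    fubini_F mu (EFin \o \1_(band_set E a b x e)).
  by rewrite indic_fubini_tonelli_FE //; apply/funext => z /=; rewrite band_section.
rewrite indic_fubini_tonelli // indic_fubini_tonelli_GE //.
have -> : mu \o ysection (band_set E a b x e) =
    (fun t => (b - a)%:E * (\1_E t)%:E : \bar R)%E.
  apply/funext => t /=; rewrite indicE.
  have [/set_mem Et|/negP Et] := boolP (t \in E).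
    have -> : ysection (band_set E a b x e) t = [set` `[a - x - t * e, b - x - t * e]].
      apply/seteqP; split => z; rewrite /ysection /= in_itv /=.
        by move=> /set_mem [_ /=]; lra.
      by move=> h; apply/mem_set; split => //=; lra.
    rewrite /mu lebesgue_measure_itv /= lte_fin mule1.
    case: ifPn => [_|]; first by rewrite -EFinB; congr EFin; ring.
    by rewrite -leNgt => h; congr EFin; lra.
  have -> : ysection (band_set E a b x e) t = set0.
    apply/seteqP; split => z //; rewrite /ysection /= => /set_mem [/= Et' _].
    by apply: Et; exact/mem_set.
  by rewrite /mu measure0 mule0.
rewrite ge0_integralZl //; first by rewrite integral_indic // setIT.
- by apply/measurable_EFinP; exact: measurable_indic.
- by rewrite lee_fin subr_ge0.
Qed.

(** Averaging over the translation [z]: if every [z] in [[- eps, eps]] gave a sum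
    above [T], integrating over [z] would contradict [integral_band]. *)
Lemma band_select (E : nat -> set R) (a b c : nat -> R) x e eps T :
  0 < eps -> (forall n, measurable (E n)) -> (forall n, a n <= b n) ->
  (forall n, 0 <= c n) ->
  (\sum_(0 <= n <oo) ((c n * (b n - a n))%:E * mu (E n)) < (2 * eps * T)%:E)%E ->
  exists2 z, `|z| <= eps &
    (\sum_(0 <= n <oo) ((c n)%:E * mu (E n `&` band (a n) (b n) x e z)) <= T%:E)%E.
Proof.
move=> e0 mE ab c0 hT; apply: contrapT => hz.
pose g (z : R) : \bar R :=
  (\sum_(0 <= n <oo) ((c n)%:E * mu (E n `&` band (a n) (b n) x e z)))%E.
have gT z : `|z| <= eps -> (T%:E < g z)%E.
  by move=> ze; rewrite ltNge; apply/negP => h; apply: hz; exists z.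
have mt n : measurable_fun setT ((fun z =>
    ((c n)%:E * mu (E n `&` band (a n) (b n) x e z))%E) : R -> \bar R).
  by apply: measurable_funeM; exact: measurable_fun_band.
have t0 n z : (0 <= (c n)%:E * mu (E n `&` band (a n) (b n) x e z))%E.
  by rewrite mule_ge0 ?lee_fin.
have mg : measurable_fun setT g.
  have := @ge0_emeasurable_sum _ _ R setT _ xpredT (fun k z _ _ => t0 k z) (fun k _ => mt k).
  by [].
have ig : (\int[mu]_z g z = \sum_(0 <= n <oo) ((c n * (b n - a n))%:E * mu (E n)))%E.
  rewrite /g integral_nneseries //.
  apply: eq_eseriesr => n _; rewrite ge0_integralZl ?lee_fin //; last first.
    exact: measurable_fun_band.
  by rewrite integral_band // muleA.
have g0 z : (0 <= g z)%E by apply: nneseries_ge0 => n _ _; exact: t0.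
pose I : set R := [set` `[- eps, eps]].
have mI : measurable I by exact: measurable_itv.
have [T0|T0] := ltP T 0.
  have : (0 <= \sum_(0 <= n <oo) ((c n * (b n - a n))%:E * mu (E n)))%E.
    apply: nneseries_ge0 => n _ _; apply: mule_ge0 => //.
    by rewrite lee_fin mulr_ge0 // subr_ge0.
  move=> h; have := le_lt_trans h hT; rewrite lte_fin.
  by rewrite pmulr_rgt0 ?mulr_gt0 //; lra.
have muI : mu I = (2 * eps)%:E.
  rewrite /mu /I lebesgue_measure_itv /= lte_fin ifT; last by lra.
  by rewrite -EFinB; congr EFin; ring.
have : (\int[mu]_(z in I) (cst T%:E z) <=
        \int[mu]_(z in I) g z)%E.
  apply: ge0_le_integral => //.
  - exact: measurable_funTS.
  - by move=> z; rewrite /I /= in_itv /= -ler_norml => /gT /ltW.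
have -> : (\int[mu]_(z in I) cst T%:E z = T%:E * mu I)%E by exact: integral_cst.
rewrite muI.
have : (\int[mu]_(z in I) g z <= \int[mu]_z g z)%E.
  exact: ge0_subset_integral.
rewrite ig => h1 h2; have := lt_le_trans (le_lt_trans (le_trans h2 h1) hT) (lexx _).
by rewrite -EFinM lte_fin; lra.
Qed.

(** Cover [E] by an open set [W] of small measure and let [m t] be the measure of
    [W] between [0] and [t].  The function [f t - (s + e1) t - C m(t)] does not
    increase just after any point: inside [W] the term [m] absorbs the
    Lipschitz growth of [f], outside [W] the bound on the derivative applies.
    The supremum of the set where it is at most its initial
    value is therefore [1]. *)
Lemma lipschitz_increment (f : R -> R) K s E eta : 0 <= K ->
  (forall t t', 0 <= t <= 1 -> 0 <= t' <= 1 -> f t' - f t <= K * `|t' - t|) ->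
  measurable E -> (mu E <= eta%:E)%E ->
  (forall t, 0 <= t <= 1 -> ~ E t -> forall eps, 0 < eps ->
    exists2 r : R, 0 < r & forall h, 0 < h < r -> f (t + h) - f t <= (s + eps) * h) ->
  f 1 - f 0 <= s + (K + `|s|) * eta.
Proof.
move=> K0 lip mE Eeta dir.
have KS : 0 < K + `|s| + 1 by rewrite ltr_wpDl // addr_ge0.
apply/ler_addgt0Pr => d d0.
pose e1 := d / (2 * (K + `|s| + 1)); have e10 : 0 < e1 by rewrite divr_gt0 // mulr_gt0.
have e1E : e1 * (K + `|s| + 1) = d / 2.
  by rewrite /e1 invfM mulrA divfK // gt_eqF.
have [W [oO EO OE]] := lebesgue_regularity_outer mE
  (le_lt_trans Eeta (ltry _)) e10.
have mO : measurable W by exact: open_measurable.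
have muO : (mu W <= (eta + e1)%:E)%E.
  have -> : W = E `|` (W `\` E).
    by apply/seteqP; split => t; [move=> Ot; have [Et|Et] := pselect (E t);
      [left|right]|case=> [/EO|[]]].
  have mOE : measurable (W `\` E) by exact: measurableD.
  have h := @measureU2 _ _ _ mu _ _ mE mOE.
  by apply: le_trans h _; rewrite EFinD; apply: leeD => //; exact: ltW.
have mOI (i : interval R) : measurable (W `&` [set` i]).
  by apply: measurableI => //; exact: measurable_itv.
have fin A : measurable A -> A `<=` W -> mu A \is a fin_num.
  move=> mA AO; apply/fin_numPlt; rewrite (lt_le_trans (ltNyr 0)) //=.
  by apply: le_lt_trans (ltry (eta + e1)); apply: le_trans muO; apply: le_measure; rewrite ?inE.
pose m t := fine (mu (W `&` [set` `]0, t]])).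
have mmono t t' : t <= t' -> m t <= m t'.
  move=> tt; apply: fine_le; try (apply: fin => //; exact: subIsetl).
  apply: le_measure; rewrite ?inE; try exact: mOI.
  by move=> z [Oz]; rewrite /= !in_itv /= => h; split => //; lra.
have m0 t : 0 <= m t by apply: fine_ge0.
have m1 : m 1 <= eta + e1.
  rewrite -lee_fin fineK; last by apply: fin => //; exact: subIsetl.
  by apply: le_trans muO; apply: le_measure; rewrite ?inE;
    [exact: mOI|exact: mO|exact: subIsetl].
have mstep t h : 0 <= t -> 0 < h -> (forall z, t < z -> z <= t + h -> W z) ->
    m t + h <= m (t + h).
  move=> t0 h0 hO.
  pose J : set R := [set` `]t, t + h]].
  have mJ : measurable J by exact: measurable_itv.
  have muJ : mu J = h%:E.
    rewrite /mu /J lebesgue_measure_itv /= lte_fin ltrDl h0 -EFinB.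
    by congr EFin; ring.
  pose Wt : set R := W `&` [set` `]0, t]].
  have mWt : measurable Wt by exact: mOI.
  have dis : Wt `&` J = set0.
    by apply/seteqP; split => z // [[_]]; rewrite /J /= !in_itv /=; lra.
  have JW : J `<=` W.
    by move=> z; rewrite /J /= in_itv /= => /andP [z1 z2]; exact: hO.
  have muU : (mu (Wt `|` J) = mu Wt + mu J)%E by exact: (@measureU _ _ _ mu).
  have finWt : mu Wt \is a fin_num by apply: fin => //; exact: subIsetl.
  have -> : m t + h = fine (mu (Wt `|` J)) by rewrite muU muJ fineD.
  have sub : Wt `|` J `<=` W `&` [set` `]0, t + h]].
    move=> z [[Wz]|Jz].
      by rewrite /= !in_itv /= => hz; split => //; lra.
    split; first exact: JW.
    by move: Jz; rewrite /J /= !in_itv /=; lra.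
  apply: fine_le.
  - apply: fin; first exact: measurableU.
    by apply: subset_trans sub _; exact: subIsetl.
  - by apply: fin => //; exact: subIsetl.
  - apply: le_measure; rewrite ?inE; [exact: measurableU|exact: mOI|exact: sub].
pose C := K + `|s|.
have C0 : 0 <= C by rewrite addr_ge0.
pose G t := f t - f 0 - (s + e1) * t - C * m t.
pose A : set R := [set t : R | 0 <= t <= 1 /\ G t <= 0].
have A0 : A 0.
  split; first by rewrite lexx ler01.
  by rewrite /G mulr0 subrr subr0 sub0r oppr_le0 mulr_ge0.
have hA : has_sup A by split; [exists 0|exists 1 => t [/andP [] //]].
pose tau := sup A.
have tau0 : 0 <= tau by apply: (sup_upper_bound hA).
have tau1 : tau <= 1 by apply: ge_sup; [exists 0|move=> t [/andP [] //]].
have tau01 : 0 <= tau <= 1 by rewrite tau0.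
have sK : - `|s| <= s by have := ler_norm (- s); rewrite normrN; lra.
(* [m] is monotone and [f] Lipschitz, so the bound is inherited from the left. *)
have Gtau : G tau <= 0.
  apply/ler_addgt0Pr => q q0; rewrite add0r.
  pose q1 := q / (C + `|s| + K + 1).
  have D0 : 0 < C + `|s| + K + 1 by have := normr_ge0 s; lra.
  have q10 : 0 < q1 by rewrite divr_gt0.
  have q1E : q1 * (C + `|s| + K + 1) = q by rewrite /q1 divfK // gt_eqF.
  have [t [t01 Gt] ht] := sup_adherent q10 hA.
  have ttau : t <= tau by apply: (sup_upper_bound hA); split.
  have := lip t tau t01 tau01; rewrite ger0_norm ?subr_ge0 // => h1.
  have h2 := mmono _ _ ttau.
  have h3 : C * m t <= C * m tau by rewrite ler_wpM2l.
  have h4 : (tau - t) * (C + `|s| + K + 1) <= q.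
    by rewrite -q1E ler_pM2r // /tau; lra.
  have h5 : 0 <= (tau - t) * (`|s| + s) by rewrite mulr_ge0 ?subr_ge0 //; lra.
  have h6 : 0 <= (tau - t) * e1 by rewrite mulr_ge0 ?subr_ge0 // ltW.
  have h7 : 0 <= (tau - t) * C by rewrite mulr_ge0 ?subr_ge0.
  by rewrite /G in Gt *; lra.
have tauE : tau = 1.
  apply/eqP; rewrite eq_le tau1 /= leNgt; apply/negP => tlt.
  suff [h [h0 h1 Gh]] : exists h, [/\ 0 < h, tau + h <= 1 & G (tau + h) <= 0].
    have : tau + h <= tau by apply: (sup_upper_bound hA); split => //; lra.
    by lra.
  have [Ot|Ot] := pselect (W tau).
    have /near_normP [r r0 hr] : \forall z \near tau, W z by exact: open_nbhs_nbhs.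
    pose h := Num.min (r / 2) (1 - tau).
    have h0 : 0 < h by rewrite lt_min divr_gt0 // subr_gt0.
    have hr2 : h <= r / 2 by rewrite ge_min lexx.
    have h1 : h <= 1 - tau by rewrite ge_min lexx orbT.
    exists h; split => //; first by lra.
    have h2 : m tau + h <= m (tau + h).
      by apply: mstep => // z z1 z2; apply: hr; rewrite ger0_norm; lra.
    have h3 : C * (m tau + h) <= C * m (tau + h) by rewrite ler_wpM2l.
    have := lip tau (tau + h) tau01; rewrite addrAC subrr add0r gtr0_norm //.
    move=> /(_ ltac:(lra)) h4.
    have h5 : 0 <= h * (`|s| + s) by rewrite mulr_ge0 ?(ltW h0) //; lra.
    have h6 : 0 < h * e1 by rewrite mulr_gt0.
    by rewrite /G /C in Gtau h3 *; lra.
  have Et : ~ E tau by move=> /EO.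
  have [r r0 hr] := dir tau tau01 Et e1 e10.
  pose h := Num.min (r / 2) (1 - tau).
  have h0 : 0 < h by rewrite lt_min divr_gt0 // subr_gt0.
  have hr2 : h <= r / 2 by rewrite ge_min lexx.
  have h1 : h <= 1 - tau by rewrite ge_min lexx orbT.
  exists h; split => //; first by lra.
  have := hr h; rewrite h0 => /(_ ltac:(lra)) h2.
  have h3 : C * m tau <= C * m (tau + h) by rewrite ler_wpM2l //; apply: mmono; lra.
  by rewrite /G in Gtau *; lra.
have := Gtau; rewrite tauE /G mulr1 => G1.
have : C * m 1 <= C * (eta + e1) by rewrite ler_wpM2l.
by rewrite /C in G1 *; lra.
Qed.

End Slicing.

Section NullLines.
Variables (R : realType) (N : nat).
Let mu := @lebesgue_measure R.
Implicit Types (Z : set 'rV[R]_N) (x y z p e : 'rV[R]_N) (s t eps eta : R).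

(** Translate the line by [z], choosing the coordinates of [z] one after the
    other by [band_select].  After [j] choices, [E n] contains the parameters at
    which the first [j] coordinates of the line lie in those of the [n]-th box
    of a covering of [Z], weighted by the product of the remaining sides; each
    choice multiplies the total weight by at most [1 / eps]. *)
Lemma null_set_line Z x e eps eta : lebesgue_outer Z = 0%E -> 0 < eps -> 0 < eta ->
  exists z (E : set R), [/\ `|z| <= eps, measurable E, (mu E <= eta%:E)%E &
    forall t, 0 <= t <= 1 -> Z (x + z + t *: e) -> E t].
Proof.
move=> Z0 eps0 eta0.
(* The [N] choices below multiply the total volume by at most [eps ^- N]. *)
pose th := eta * eps ^+ N.
have th0 : 0 < th by rewrite mulr_gt0 // exprn_gt0.
have [_ [F [Fab ZF] <-] hF] : exists2 v, [set (\sum_(0 <= n <oo) (box_volume (F n))%:E)%E | F in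
    [set F : nat -> 'rV[R]_N * 'rV[R]_N |
      (forall n k, (F n).1 ord0 k <= (F n).2 ord0 k) /\
      Z `<=` \bigcup_n box (F n)]] v & (v < th%:E)%E.
  by apply: ereal_inf_lt; rewrite -/(lebesgue_outer Z) Z0 lte_fin.
pose len n (k : 'I_N) := (F n).2 ord0 k - (F n).1 ord0 k.
have len0 n k : 0 <= len n k by rewrite subr_ge0.
have step j : (j <= N)%N -> exists z (E : nat -> set R), [/\ `|z| <= eps,
   forall n, measurable (E n),
   forall n t, 0 <= t <= 1 ->
     (forall k : 'I_N, (k < j)%N ->
        (F n).1 ord0 k <= (x + z + t *: e) ord0 k <= (F n).2 ord0 k) -> E n t &
   (\sum_(0 <= n <oo) ((\prod_(k < N | (j <= k)%N) len n k)%:E * mu (E n))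
      <= (th / eps ^+ j)%:E)%E].
  elim: j => [_|j IH jN].
    exists 0, (fun=> [set` `[0, 1]]); split => //; first by rewrite normr0 ltW.
    rewrite expr0 divr1; apply: le_trans (ltW hF); apply: lee_nneseries => n _.
      by move=> _; rewrite mule_ge0 // lee_fin prodr_ge0.
    by rewrite /mu lebesgue_measure_itv /= lte_fin ltr01 sube0 mule1.
  have [z [E [ze mE hE hT]]] := IH (ltnW jN).
  pose j' := Ordinal jN.
  pose c n := \prod_(k < N | (j < k)%N) len n k.
  have c0 n : 0 <= c n by apply: prodr_ge0.
  have cE n : \prod_(k < N | (j <= k)%N) len n k = c n * len n j'.
    rewrite (bigD1 j') //= mulrC; congr (_ * _); apply: eq_bigl => k.
    by rewrite ltn_neqAle andbC eq_sym.
  pose T := th / eps ^+ j.+1.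
  have T0 : 0 < T by rewrite divr_gt0 // exprn_gt0.
  have TE : th / eps ^+ j = eps * T.
    by rewrite /T exprS invfM mulrCA mulVKf // gt_eqF.
  have [|||zeta zeps hz] := @band_select R E (fun n => (F n).1 ord0 j')
      (fun n => (F n).2 ord0 j') c (x ord0 j') (e ord0 j') eps T eps0 mE.
  - by move=> n; exact: Fab.
  - exact: c0.
  - under eq_eseriesr do rewrite -/(len _ j') -cE.
    apply: le_lt_trans hT _; rewrite lte_fin TE -mulrA ltr_pMl ?ltr1n //.
    by rewrite mulr_gt0.
  exists (\row_k (if k == j' then zeta else z ord0 k)).
  exists (fun n => E n `&` band ((F n).1 ord0 j') ((F n).2 ord0 j')
     (x ord0 j') (e ord0 j') zeta).
  split => //.
  - apply: norm_le_coord; first exact: ltW.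
    move=> k; rewrite mxE; case: eqP => // _.
    exact: le_trans (coord_le_norm z k) ze.
  - by move=> n; apply: measurableI => //; exact: measurable_band.
  - move=> n t t01 hk; split.
      apply: hE => // k kj; have := hk k (ltnW kj); rewrite !mxE.
      by case: eqP => // kj'; move: kj; rewrite kj' /= ltnn.
    by have := hk j' (ltnSn _); rewrite !mxE eqxx.
have [z [E [ze mE hE hT]]] := step N (leqnn _).
have mU : measurable (\bigcup_n E n) by exact: bigcup_measurable.
exists z, (\bigcup_n E n); split => //.
- apply: le_trans (_ : (\sum_(0 <= n <oo) mu (E n) <= _)%E).
    apply: (@generalized_Boole_inequality _ _ _ mu) => //.
  have -> : eta = th / eps ^+ N by rewrite /th mulfK // expf_neq0 // gt_eqF.
  apply: le_trans hT; apply: lee_nneseries => // n _.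
  rewrite big_pred0 ?mul1e // => k.
  by apply/negbTE; rewrite -ltnNge.
- by move=> t t01 /ZF [n _ bx]; exists n => //; exact: hE.
Qed.

(** The almost-everywhere analogue of [superdiff_increment].  On a translated
    segment that meets [Z] in a set of small length the one-dimensional bound
    applies, and the Lipschitz constant pays for the translation. *)
Lemma ae_increment (u : 'rV[R]_N -> R) L Z y e s rho : 0 < L ->
  (forall x z, u x - u z <= L * `|x - z|) -> lebesgue_outer Z = 0%E -> 0 < rho ->
  (forall t x, 0 <= t <= 1 -> `|x - (y + t *: e)| < rho -> ~ Z x ->
     differentiable u x /\ dot (gradient u x) e <= s) ->
  u (y + e) <= u y + s.
Proof.
move=> L0 lip Z0 rho0 hD.
apply/ler_addgt0Pr => d d0.
pose K := L * `|e|; have K0 : 0 <= K by rewrite mulr_ge0 // ltW.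
pose eps := Num.min (rho / 2) (d / 2 / (2 * L)).
have eps0 : 0 < eps by rewrite lt_min !divr_gt0 // mulr_gt0.
have eps_rho : eps < rho by rewrite gt_min; apply/orP; left; lra.
have epsL : eps * (2 * L) <= d / 2.
  by rewrite -ler_pdivlMr ?mulr_gt0 // ge_min lexx orbT.
pose eta := d / 2 / (K + `|s| + 1).
have KS : 0 < K + `|s| + 1 by rewrite ltr_wpDl // addr_ge0.
have eta0 : 0 < eta by rewrite !divr_gt0.
have etaE : eta * (K + `|s| + 1) = d / 2 by rewrite /eta divfK // gt_eqF.
have [z [E [zeps mE Eeta hE]]] := null_set_line y e Z0 eps0 eta0.
have : u (y + z + 1 *: e) - u (y + z + 0 *: e) <= s + (K + `|s|) * eta.
  apply: (lipschitz_increment (f := fun t => u (y + z + t *: e)) K0 _ mE Eeta).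
    move=> t t' _ _; apply: le_trans (lip _ _) _.
    by rewrite /K -mulrA ler_pM2l // opprD addrACA subrr add0r -scalerBl normrZ mulrC.
  move=> t t01 Et eps1 eps10.
  have [du dd] : differentiable u (y + z + t *: e) /\
      dot (gradient u (y + z + t *: e)) e <= s.
    apply: (hD t) => //; last by move=> /(hE t t01).
    by rewrite opprD addrACA [y + z]addrC addrK subrr addr0; lra.
  have e20 : 0 < eps1 / (`|e| + 1) by rewrite divr_gt0 // ltr_wpDl.
  have [r r0 hr] := diff_expands du e20.
  have [r1 r10 hr1] := small_step e r0.
  exists r1 => // h hh; have h0 : 0 < h by case/andP: hh.
  have := hr _ (hr1 _ hh); rewrite dotZr normrZ gtr0_norm // ler_norml => /andP [_].
  have -> : y + z + t *: e + h *: e = y + z + (t + h) *: e by rewrite scalerDl addrA.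
  have h1 : eps1 / (`|e| + 1) * (h * `|e|) <= eps1 * h.
    rewrite -mulrA ler_pM2l // mulrC ler_pdivrMr ?ltr_wpDl //.
    by rewrite ler_pM2l // lerDl.
  have h2 : h * dot (gradient u (y + z + t *: e)) e <= h * s by rewrite ler_pM2l.
  by lra.
rewrite scale1r scale0r addr0 => h1.
have h2 := lip (y + e) (y + z + e); have h3 := lip (y + z) y.
rewrite opprD addrACA subrr addr0 opprD addrA subrr add0r normrN in h2.
rewrite addrAC subrr add0r in h3.
have h4 : L * `|z| <= L * eps by rewrite ler_pM2l.
by lra.
Qed.

End NullLines.

(** * From almost-everywhere strictness to viscosity strictness *)

Section AlmostEverywhere.
Variables (R : realType) (N m : nat).
Variables (H : 'I_m -> 'rV[R]_N -> 'rV[R]_N -> R) (B : 'rV[R]_N -> 'M[R]_m).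
Hypothesis hH : forall i, convex_hamiltonian (H i).
Hypothesis hBcont : forall i j, continuous (fun x => B x i j).
Hypothesis hBper : torus_fun B.
Hypothesis hBdeg : forall x, degenerate_coupling_matrix (B x).
Hypothesis hBirr : forall x, irreducible_matrix (B x).
Implicit Types (u v w : 'I_m -> 'rV[R]_N -> R) (x y z p q e : 'rV[R]_N).
Implicit Types (a c r s t eta eps : R) (i j k : 'I_m).

(** A half-space separating a violating superdifferential at [x0] from the
    sublevel contains the gradients of [v_i] at almost every point near [x0],
    so it bounds the increments of [v_i] near [x0]. *)
Lemma ae_strict_visc v i y : subsolution H B 0 v -> strict_component_at H B v i y ->
  visc_strict H B v i y.
Proof.
move=> sv [V [delta [oV Vy d0 ae]]].
have [cv hv] := sv.
have [C [L [C0 L0 hCL]]] := subsolution_bounds hH hBcont hBper hBdeg hBirr 0.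
have [_ lip] := hCL _ sv.
have /near_normP [rho rho0 hrho] : \forall x \near y, V x by exact: open_nbhs_nbhs.
exists rho, (delta / 2); split => //; first by rewrite divr_gt0.
move=> x0 p x0r sp; rewrite leNgt; apply/negP => lt.
pose eta := delta / 8; have e0 : 0 < eta by rewrite divr_gt0.
have [e [s [r [se r0 hr]]]] : exists e s r, [/\ s < dot p e, 0 < r &
    forall x' q, `|x' - x0| < r ->
      H i x' q <= - coupling_term B v x0 i - 6 * eta -> dot q e <= s].
  by apply: (ham_support (hH i)) (lexx _); rewrite /eta; lra.
have ccv := @coupling_cont _ _ _ _ hBcont v i (fun k => proj1 (cv k)).
have /cont_normP /(_ _ e0) [r1 r10 hr1] := ccv x0.
pose r2 := Num.min (Num.min r r1) (rho - `|x0 - y|) / 2.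
have r20 : 0 < r2 by rewrite divr_gt0 // !lt_min r0 r10 subr_gt0.
have r2E : r2 * 2 = Num.min (Num.min r r1) (rho - `|x0 - y|) by rewrite divfK.
have [t1 t10 ht1] := small_step e r20.
suff : dot p e <= s by lra.
apply: (superdiff_slope_le t10 sp) => t tt.
have t0 : 0 < t by case/andP: tt.
rewrite -{1}[x0](subrK (t *: e)).
apply: (ae_increment L0 (lip i) ae r20) => t' x t'01 xr nZ.
have : `|x - x0| < r2 * 2.
  have -> : x - x0 = (x - (x0 - t *: e + t' *: (t *: e))) + (t' - 1) *: (t *: e).
    by apply/rowP => k; rewrite !mxE; ring.
  have : `|(t' - 1) *: (t *: e)| <= `|t *: e|.
    rewrite normrZ ler_piMl // ler_norml; lra.
  have := ht1 _ tt.
  have := ler_normD (x - (x0 - t *: e + t' *: (t *: e))) ((t' - 1) *: (t *: e)).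
  lra.
rewrite r2E !lt_min => /andP [/andP [x1 x2] x3].
have Vx : V x by apply: hrho; have := ler_distD x0 x y; lra.
have [du hx] : differentiable (v i) x /\
    H i x (gradient (v i) x) + coupling_term B v x i < - delta.
  by apply: contrapT => h; apply: nZ.
split => //; rewrite dotZr mulrC ler_pM2r //; apply: (hr x) => //.
have := hr1 _ x2; rewrite ltr_norml => /andP [h4 _].
by rewrite /eta in h4 *; lra.
Qed.

(** A degenerate box has volume [0] only in positive dimension. *)
Lemma lebesgue_outer0 : (0 < N)%N -> lebesgue_outer (set0 : set 'rV[R]_N) = 0%E.
Proof.
move=> N0; apply/eqP; rewrite eq_le; apply/andP; split.
  apply: ereal_inf_lbound => /=.
  exists (fun=> (0, 0)); first by split.
  apply: eseries0 => n _ _; congr EFin.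
  rewrite /box_volume; case: (N) N0 => // n' _.
  by rewrite big_ord_recl !mxE subrr mul0r.
apply: le_ereal_inf_tmp => _ [F [Fab _] <-].
apply: nneseries_ge0 => n _ _; rewrite lee_fin; apply: prodr_ge0 => k _.
by rewrite subr_ge0.
Qed.

Lemma smooth_strict_strict w i y : (0 < N)%N -> subsolution H B 0 w ->
  smooth_strict H B w i y -> strict_component_at H B w i y.
Proof.
move=> N0 [cw _] [C1 neg].
have [r r0 hr] := C1_nearE C1.
pose eta := - (H i y (gradient (w i) y) + coupling_term B w y i) / 3.
have e0 : 0 < eta by rewrite divr_gt0 // oppr_gt0.
have e3 : eta * 3 = - (H i y (gradient (w i) y) + coupling_term B w y i).
  by rewrite /eta divfK.
clearbody eta.
have [r1 r10 hr1] := ham_unif (hH i) `|gradient (w i) y| e0.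
have [_ cg] := hr y ltac:(by rewrite subrr normr0).
have /cont_normP /(_ _ r10) [r2 r20 hr2] := cg.
have ccv := @coupling_cont _ _ _ _ hBcont w i (fun k => proj1 (cw k)).
have /cont_normP /(_ _ e0) [r3 r30 hr3] := ccv y.
pose s := Num.min (Num.min r r1) (Num.min r2 r3).
have s0 : 0 < s by rewrite !lt_min r0 r10 r20.
exists (ball y s), (eta / 2); split.
- exact: ball_open.
- exact: ballxx.
- by rewrite divr_gt0.
rewrite /ae_in (_ : [set x | _] = set0) ?lebesgue_outer0 //.
apply/seteqP; split => // x [ys] []; have {ys} : `|x - y| < s.
  by rewrite -ball_normE /= distrC in ys.
rewrite !lt_min => /andP [/andP [x0 x1] /andP [x2 x3]].
have [ex _] := hr _ x0; have [dx _] := expands_diff ex; split => //.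
have := hr1 y x (gradient (w i) y) (gradient (w i) x) x1 (hr2 _ x2) (lexx _).
have := hr3 _ x3; rewrite !ltr_norml => /andP [_ h1] /andP [_ h2].
by move: (H i x _) (coupling_term B w x i) h1 h2 => a b h1 h2; lra.
Qed.

(** * The equivalence *)

Hypothesis hc : critical_value H B = 0%E.

(** A smooth strict component [v_i0], shifted to vanish at [y], is a test
    function touching [Phi_{i0,i0}(y, .)] from below at [y]; the other
    components of [Phi(y, .)] are at least those of the shifted [v], so its
    coupling term is at most that of [v]. *)
Lemma Aubry_not_strict i0 i y w : subsolution H B 0 w ->
  strict_component_at H B w i y -> ~ Aubry_set H B i0 y.
Proof.
move=> sw st [_ [_ sup]].
have [v sv sm] := all_smooth_strict hH hBcont hBper hBdeg hBirr sw
  (ae_strict_visc sw st).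
have ub k x := Phi_ub hH hBcont hBper hBdeg hBirr hc k i0 y x sv.
have diag := Phi_diag hH hBcont hBper hBdeg hBirr hc i0 y.
have [C1 neg] := sm i0.
have [r r0 hr] := C1_nearE C1.
have ev : expands (v i0) y (gradient (v i0) y).
  by have [] := hr y; rewrite ?subrr ?normr0.
have sd : subdiff (fun x => Phi H B i0 i0 y x) y (gradient (v i0) y).
  apply: (subdiffI C1 ev (@ltr01 _)) => x _.
  by rewrite diag; have := ub i0 x; lra.
have := sup y i0 _ sd.
have := @coupling_le _ _ _ _ hBdeg (fun j x => v j x + - v i0 y)
  (fun k => Phi H B k i0 y) y i0 (fun j _ => ub j y).
by rewrite coupling_cst // diag subrr subrr mulr0 addr0; lra.
Qed.

(** The supersolution property can fail only at [y]: elsewhere one could raise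
    [Phi(y, .)] without changing it on the orbit of [y], against the
    maximality of [Phi]. *)
Lemma not_Aubry_strict i0 y : (0 < N)%N -> ~ Aubry_set H B i0 y -> exists2 w, subsolution H B 0 w &
  forall k, smooth_strict H B w k y.
Proof.
move=> N0 nA.
have su := Phi_subsolution hH hBcont hBper hBdeg hBirr hc i0 y.
set u := (fun k => Phi H B k i0 y) in su.
have [cu hu] := su.
have [x [k [p [sp neg]]]] : exists x k p, subdiff (u k) x p /\
    H k x p + coupling_term B u x k < 0.
  apply: contrapT => h; apply: nA; split => //; split => // x k p sp.
  rewrite leNgt; apply/negP => lt; apply: h.
  by exists x, k, p.
have pu j : torus_fun (u j) by case: (cu j).
have {sp} sp := subdiff_periodic (near_rep y x) (pu k) sp.
have {}neg : H k (rep y x) p + coupling_term B u (rep y x) k < 0.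
  by rewrite (rep_fun y x (ham_per (hH k) p)) /rep coupling_per.
rewrite -/(rep y x) in sp.
have [xy|xy] := eqVneq (rep y x) y.
  rewrite xy in sp neg.
  have [w [rw ss _ _]] := smooth_raise hH hBcont hBper hBdeg su sp neg (@ltr01 R).
  have [sw _ _] := rw.
  apply: (all_smooth_strict hH hBcont hBper hBdeg hBirr sw (i := k)).
  exact: (ae_strict_visc sw (smooth_strict_strict N0 sw ss)).
exfalso; move: (rep y x) (rep_near y x) sp neg xy => a ay sp neg an.
have /existsP [i ai] : [exists i, a ord0 i != y ord0 i].
  apply: contraNT an; rewrite negb_exists => /forallP h; apply/eqP/rowP => i.
  by apply/eqP; have := h i; rewrite negbK.
(* As [a] is within [1/2] of [y], no lattice translate of [y] is closer to [a]
   than [d] in the [i]-th coordinate. *)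
pose d := `|a ord0 i - y ord0 i|.
have d0 : 0 < d by rewrite normr_gt0 subr_eq0.
have d2 : d <= 2^-1 by have := coord_le_norm (a - y) i; rewrite !mxE /d; lra.
have [w [[sw uw wu] _ lt wout]] := smooth_raise hH hBcont hBper hBdeg su sp neg d0.
have wky : w k y = u k y.
  apply: wout => q; apply: le_trans (coord_le_norm _ i); rewrite !mxE.
  have [->|q0] := eqVneq (q ord0 i) 0; first by rewrite addr0 distrC.
  have : 1 <= `|(q ord0 i)%:~R : R|.
    by rewrite -intr_norm -[1]/(1%:~R) ler_int -gtz0_ge1 normr_gt0.
  have := ler_normD (y ord0 i + (q ord0 i)%:~R - a ord0 i) (a ord0 i - y ord0 i).
  have -> : y ord0 i + (q ord0 i)%:~R - a ord0 i + (a ord0 i - y ord0 i) =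
    (q ord0 i)%:~R by ring.
  by rewrite -/d; lra.
have wi0 : w i0 y = 0.
  have := Phi_diag hH hBcont hBper hBdeg hBirr hc i0 y; rewrite -/(u i0 y).
  have [<-|ki] := eqVneq k i0; first by rewrite wky.
  by rewrite wu // eq_sym.
have := Phi_ub hH hBcont hBper hBdeg hBirr hc k i0 y a sw.
by rewrite wi0 subr0 -/(u k a); lra.
Qed.

End AlmostEverywhere.

Theorem theorem3p13 (R : realType) (N m : nat) (hN : (0 < N)%N) (hm : (0 < m)%N)
    (H : 'I_m -> 'rV[R]_N -> 'rV[R]_N -> R) (B : 'rV[R]_N -> 'M[R]_m)
    (hH : forall i, convex_hamiltonian (H i))
    (hBcont : forall i j, continuous (fun x => B x i j))
    (hBper : torus_fun B)
    (hBdeg : forall x, degenerate_coupling_matrix (B x))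
    (hBirr : forall x, irreducible_matrix (B x))
    (hc : critical_value H B = 0%E)
    (i0 : 'I_m) (y : 'rV[R]_N) :
  [<-> ~ Aubry_set H B i0 y;
       exists w, subsolution H B 0 w /\ strict_at H B w y;
       exists w i, subsolution H B 0 w /\ strict_component_at H B w i y].
Proof.
tfae.
- move=> nA; have [w sw ss] := not_Aubry_strict hH hBcont hBper hBdeg hBirr hc hN nA.
  exists w; split => // k.
  exact: (smooth_strict_strict hH hBcont hN sw (ss k)).
- by move=> [w [sw st]]; exists w, i0.
- move=> [w [i [sw st]]].
  exact: (Aubry_not_strict hH hBcont hBper hBdeg hBirr hc sw st).
Qed.
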